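(* Consider the causal secure source coding model with degraded side information described in the context. A quadruple $(R,R_k,D,h)$ belongs to $\mathcal{R}_{SI}$ if and only if $$R\ge \underline{r}_c^{SI}(D),\qquad h\le H(X\mid W),\qquad R_k\ge h-H(X\mid W)+\underline{r}_c^{SI}(D).$$
   Context: A memoryless source emits i.i.d. triples $(X_t,Y_t,W_t)$ on finite alphabets with joint law $P(x)P(y\mid x)P(w\mid y)$ (so $X\leftrightarrow Y\leftrightarrow W$). Alice observes $X^n$, Bob observes side information $Y^n$, the eavesdropper Eve observes $W^n$. Alice and Bob share a secret key $K$ taking finitely many values, independent of the source. A causal reproduction coder consists of causal encoding functions producing messages $S_t=e_t(K,X^t)$ (in a finite alphabet) and causal decoding functions $\hat X_t=g_t(K,S^t,Y^t)\in\hat{\mathcal{X}}$ ($\hat{\mathcal{X}}$ finite). Alice transmits a binary string $\mathbf{Z}$, a function of $(K,X^n)$, and it is required that for every $\epsilon>0$ and large enough $n$, $P(S^n\ne g(K,Y^n,\mathbf{Z}))<\epsilon$ for some function $g$. A distortion measure $d:\mathcal{X}\times\hat{\mathcal{X}}\to[0,\infty)$ is given. $\mathcal{R}_{SI}$ is the set of quadruples $(R,R_k,D,h)$ of positive reals such that for every $\epsilon>0$ and sufficiently large $n$ there exist an encoder and decoder inducing a causal reproduction coder with $\frac1nH(\mathbf{Z})\le R+\epsilon$, $\frac1nH(K)\le R_k+\epsilon$, $\frac1n\sum_{t=1}^n\mathbb{E}\,d(X_t,\hat X_t)\le D+\epsilon$, and $\frac1nH(X^n\mid W^n,\mathbf{Z})\ge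 h-\epsilon$. Define $r_c^{SI}(D)=\min H(f(X)\mid Y)$ over finite alphabets $\mathcal{S}$ with $|\mathcal{S}|\le|\mathcal{X}|$ and functions $f:\mathcal{X}\to\mathcal{S}$, $g:\mathcal{S}\times\mathcal{Y}\to\hat{\mathcal{X}}$ satisfying $\mathbb{E}\,d(X,g(f(X),Y))\le D$; $\underline{r}_c^{SI}(D)$ is the lower convex envelope of $r_c^{SI}(D)$. *)

(* Defs.v *)
From HB Require Import structures.
From mathcomp Require Import all_boot all_order all_algebra.
From mathcomp Require Import all_classical all_reals all_analysis.
Set Implicit Arguments. Unset Strict Implicit. Unset Printing Implicit Defensive.
Import Order.TTheory GRing.Theory Num.Theory.
Local Open Scope ring_scope.
Local Open Scope classical_set_scope.

Section Info.
Variable R : realType.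

Definition log2 (x : R) : R := ln x / ln 2.

Definition is_pmf (T : finType) (p : T -> R) : Prop :=
  (forall t, 0 <= p t) /\ \sum_(t : T) p t = 1.

Definition pval (T : finType) (U : eqType) (p : T -> R) (F : T -> U) (u : U) : R :=
  \sum_(w : T | F w == u) p w.

(* Shannon entropy (bits) of the random variable F : T -> U, T finite with pmf p:
   H(F) = - sum_u P(F=u) log P(F=u) = - E[log P(F = F w)] *)
Definition entropy (T : finType) (U : eqType) (p : T -> R) (F : T -> U) : R :=
  - \sum_(w : T) p w * log2 (pval p F (F w)).

Definition condEntropy (T : finType) (U V : eqType) (p : T -> R)
  (F : T -> U) (G : T -> V) : R :=
  entropy p (fun w => (F w, G w)) - entropy p G.

Variables (X Y W Xh : finType).
Variables (PX : X -> R) (PYX : X -> Y -> R) (PWY : Y -> W -> R) (d : X -> Xh -> R).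

Definition pXY (xy : X * Y) : R := PX xy.1 * PYX xy.1 xy.2.
Definition pXYW (xyw : X * Y * W) : R :=
  PX xyw.1.1 * PYX xyw.1.1 xyw.1.2 * PWY xyw.1.2 xyw.2.

Definition HXgW : R := condEntropy pXYW (fun w => w.1.1) (fun w => w.2).

(* r_c^{SI}(D) = min H(f(X)|Y) over |S| <= |X|, f : X -> S, g : S * Y -> Xhat
   with E d(X, g(f(X),Y)) <= D ; +oo if infeasible. S is taken as 'I_m, m <= |X|. *)
Definition rcSI (D : R) : \bar R :=
  ereal_inf [set v | exists (m : nat) (f : X -> 'I_m) (g : 'I_m -> Y -> Xh),
     [/\ (m <= #|X|)%N,
         \sum_(xy : X * Y) pXY xy * d xy.1 (g (f xy.1) xy.2) <= D &
         v = (condEntropy pXY (fun xy => f xy.1) (fun xy => xy.2))%:E]].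

Definition lce (phi : R -> \bar R) (D : R) : \bar R :=
  ereal_inf [set v | exists (k : nat) (lam : 'I_k -> R) (Ds : 'I_k -> R),
     [/\ (forall i, 0 < lam i), \sum_i lam i = 1, \sum_i lam i * Ds i = D &
         v = (\sum_i ((lam i)%:E * phi (Ds i)))%E]].

Section Block.
Variables (n mK mS : nat).
Definition Omega := ('I_mK * ({ffun 'I_n -> X} * {ffun 'I_n -> Y} * {ffun 'I_n -> W}))%type.

Definition kof (o : Omega) : 'I_mK := o.1.
Definition xof (o : Omega) : {ffun 'I_n -> X} := o.2.1.1.
Definition yof (o : Omega) : {ffun 'I_n -> Y} := o.2.1.2.
Definition wof (o : Omega) : {ffun 'I_n -> W} := o.2.2.

Definition pOmega (pK : 'I_mK -> R) (o : Omega) : R :=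
  pK (kof o) * \prod_(t < n) (PX (xof o t) * PYX (xof o t) (yof o t) * PWY (yof o t) (wof o t)).

Definition causal_enc (e : 'I_n -> 'I_mK -> {ffun 'I_n -> X} -> 'I_mS) : Prop :=
  forall (t : 'I_n) k (x x' : {ffun 'I_n -> X}),
    (forall i : 'I_n, (i <= t)%N -> x i = x' i) -> e t k x = e t k x'.

Definition causal_dec
  (g : 'I_n -> 'I_mK -> {ffun 'I_n -> 'I_mS} -> {ffun 'I_n -> Y} -> Xh) : Prop :=
  forall (t : 'I_n) k (s s' : {ffun 'I_n -> 'I_mS}) (y y' : {ffun 'I_n -> Y}),
    (forall i : 'I_n, (i <= t)%N -> s i = s' i /\ y i = y' i) ->
    g t k s y = g t k s' y'.

Definition Sseq (e : 'I_n -> 'I_mK -> {ffun 'I_n -> X} -> 'I_mS) (o : Omega)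
  : {ffun 'I_n -> 'I_mS} := [ffun t => e t (kof o) (xof o)].
End Block.

Definition inRSI (Rr Rk D h : R) : Prop :=
  forall eps : R, 0 < eps -> exists N : nat, forall n : nat, (N <= n)%N ->
  exists (mK mS : nat) (pK : 'I_mK -> R)
         (e : 'I_n -> 'I_mK -> {ffun 'I_n -> X} -> 'I_mS)
         (g : 'I_n -> 'I_mK -> {ffun 'I_n -> 'I_mS} -> {ffun 'I_n -> Y} -> Xh)
         (Z : 'I_mK -> {ffun 'I_n -> X} -> seq bool)
         (gZ : 'I_mK -> {ffun 'I_n -> Y} -> seq bool -> {ffun 'I_n -> 'I_mS}),
    let p := pOmega pK in
    let Zo := fun o : Omega n mK => Z (kof o) (xof o) in
    is_pmf pK /\ causal_enc e /\ causal_dec g /\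
        \sum_(o : Omega n mK | Sseq e o != gZ (kof o) (yof o) (Zo o)) p o < eps /\
        entropy p Zo / n%:R <= Rr + eps /\
        entropy p (@kof n mK) / n%:R <= Rk + eps /\
        (\sum_(t < n) \sum_(o : Omega n mK)
            p o * d (xof o t) (g t (kof o) (Sseq e o) (yof o))) / n%:R <= D + eps /\
        condEntropy p (@xof n mK) (fun o => (wof o, Zo o)) / n%:R >= h - eps.

End Info.

(* Main.v *)
(* Converse.  Condition throughout on (K, Y^n, W^n).  Given in addition the past
   x^{t-1} of the source, the t-th encoder and decoder form a scalar code whose rate and
   distortion are those of r_c^{SI}; the chain rule hence gives
   H(S^n | K, Y^n, W^n) >= n r(D), where r is the lower convex envelope.  Fano's
   inequality applies because, given K, S^n takes at most |X|^n values whatever the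
   message alphabet.  The key bound is
   H(X^n | W^n, Z) <= H(K) + n H(X|W) - H(Z | K, Y^n, W^n).  The envelope is
   right-continuous since there are finitely many scalar codes.

   Direct part.  Time-share scalar codes, compress S^n to L bits by random binning with
   side information Y^n, and mask m of these bits by a uniform m-bit key.  Since
   (X^n, W^n, Z) determines K, H(X^n, W^n, Z) = n H(X,W) + m, while
   H(W^n, Z) <= n H(W) + L; so the equivocation is at least n H(X|W) + m - L. *)
Require Import Defs.
From HB Require Import structures.
From mathcomp Require Import all_boot all_order all_algebra.
From mathcomp Require Import all_classical all_reals all_analysis.
From mathcomp Require Import ring lra.
Set Implicit Arguments. Unset Strict Implicit. Unset Printing Implicit Defensive.
Import Order.TTheory GRing.Theory Num.Theory.
Local Open Scope ring_scope.

(** * Entropy on a finite probability space *)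

(** The envelope is an infimum that may be +oo, and a code of finite length only yields a point (D +
    delta, r + delta). Hence the proof never computes with the envelope: it works with finite
    mixtures of scalar codes ([achievable]), translates through [lceP], and removes the delta in D
    once, in [achievable_right_continuous]. The delicate point there is the smallest attainable
    distortion, to the left of which the envelope jumps to +oo.

    Conditioning on W^n in the converse costs nothing, because given Y_t the letter W_t says nothing
    more about X_t. It is needed because the bound on Eve's equivocation involves H(Z | K, W^n), and
    this dominates H(Z | K, Y^n, W^n).

    In the direct part the L - m unmasked bits are charged to Eve as if each revealed a full bit
    about X^n. This crude count is already tight, since L is close to n r(D).

    Conditioning, cardinality and Fano bounds all come from one Gibbs inequality, with different
    guesses q for the conditional law. *)

Section Log2.
Variable R : realType.
Implicit Types x y : R.

Lemma ln2_gt0 : 0 < ln 2 :> R.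
Proof. by rewrite ln_gt0 // ltr1n. Qed.

Lemma log2_1 : log2 1 = 0 :> R.
Proof. by rewrite /log2 ln1 mul0r. Qed.

Lemma log2M x y : 0 < x -> 0 < y -> log2 (x * y) = log2 x + log2 y.
Proof. by move=> x0 y0; rewrite /log2 lnM ?posrE// mulrDl. Qed.

Lemma log2V x : 0 < x -> log2 x^-1 = - log2 x.
Proof. by move=> x0; rewrite /log2 lnV ?posrE// mulNr. Qed.

Lemma log2_div x y : 0 < x -> 0 < y -> log2 (x / y) = log2 x - log2 y.
Proof. by move=> x0 y0; rewrite log2M ?invr_gt0// log2V. Qed.

Lemma log2X n : log2 (2 ^+ n) = n%:R :> R.
Proof. by rewrite /log2 lnXn// -[X in X / _]mulr_natl mulfK// gt_eqF// ln2_gt0. Qed.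

Lemma ler_log2 x y : 0 < x -> x <= y -> log2 x <= log2 y.
Proof.
move=> x0 xy; rewrite /log2 ler_pM2r ?invr_gt0 ?ln2_gt0//.
by rewrite ler_ln ?posrE// (lt_le_trans x0).
Qed.

Lemma log2_le0 x : x <= 1 -> log2 x <= 0.
Proof.
by move=> x1; rewrite /log2 pmulr_lle0 ?invr_gt0 ?ln2_gt0// ln_le0.
Qed.

Lemma log2_prod (I : finType) (F : I -> R) :
  (forall i, 0 < F i) -> log2 (\prod_i F i) = \sum_i log2 (F i).
Proof.
move=> F0.
suff [] : 0 < \prod_i F i /\ log2 (\prod_i F i) = \sum_i log2 (F i) by [].
elim/big_rec2: _ => [|i y x _ [x0 <-]]; first by rewrite log2_1.
by rewrite log2M// mulr_gt0.
Qed.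

Lemma log2_le_subr1 x : 0 < x -> log2 x <= (x - 1) / ln 2.
Proof.
move=> x0; rewrite /log2 ler_pM2r ?invr_gt0 ?ln2_gt0//.
by rewrite -{1}(subrKC 1 x) le_ln1Dx// ltrBrDl subrr.
Qed.

End Log2.

Section FiniteEntropy.
Variables (R : realType) (T : finType) (p : T -> R).
Hypothesis hp : is_pmf p.

Let p_ge0 w : 0 <= p w. Proof. exact: hp.1. Qed.
Let sum_p : \sum_w p w = 1. Proof. exact: hp.2. Qed.

Lemma pmf_card_gt0 : (0 < #|T|)%N.
Proof.
rewrite lt0n; apply/eqP => /card0_eq T0; have := sum_p.
by rewrite big1 => [/eqP|w _]; [rewrite eq_sym oner_eq0|have := T0 w].
Qed.

Lemma le_pval (U : eqType) (F : T -> U) w : p w <= pval p F (F w).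
Proof. by rewrite /pval (bigD1 w)//= lerDl sumr_ge0. Qed.

Lemma pval_gt0 (U : eqType) (F : T -> U) w : 0 < p w -> 0 < pval p F (F w).
Proof. by move=> /lt_le_trans; apply; exact: le_pval. Qed.

Lemma pval_ge0 (U : eqType) (F : T -> U) u : 0 <= pval p F u.
Proof. exact: sumr_ge0. Qed.

Lemma pval_le1 (U : eqType) (F : T -> U) u : pval p F u <= 1.
Proof.
rewrite -sum_p /pval [leRHS](bigID (fun w => F w == u))/= lerDl.
exact: sumr_ge0.
Qed.

Lemma expect_le (f g : T -> R) :
  (forall w, 0 < p w -> f w <= g w) -> \sum_w p w * f w <= \sum_w p w * g w.
Proof.
move=> fg; apply: ler_sum => w _; have := p_ge0 w.
by rewrite le_eqVlt => /predU1P[<-|pw]; rewrite ?mul0r// ler_wpM2l// fg.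
Qed.

Lemma expect_eq (f g : T -> R) :
  (forall w, 0 < p w -> f w = g w) -> \sum_w p w * f w = \sum_w p w * g w.
Proof. by move=> fg; apply/le_anti/andP; split; apply: expect_le => w /fg ->. Qed.

Lemma entropy_ge0 (U : eqType) (F : T -> U) : 0 <= entropy p F.
Proof.
rewrite /entropy oppr_ge0 sumr_le0// => w _.
by rewrite mulr_ge0_le0// log2_le0// pval_le1.
Qed.

(** The hypothesis says that G is a function of F without naming the function. Rearranging, dropping
    or adding determined components of a tuple thus becomes a matter of equalities only. *)
Lemma entropy_le (U V : eqType) (F : T -> U) (G : T -> V) :
  (forall w w', F w = F w' -> G w = G w') -> entropy p G <= entropy p F.
Proof.
move=> FG; rewrite /entropy lerN2; apply: expect_le => w pw.
apply: ler_log2; first exact: pval_gt0.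
rewrite /pval [leRHS](bigID (fun w' => F w' == F w))/=.
rewrite -[leLHS]addr0 lerD ?sumr_ge0// le_eqVlt; apply/orP; left; apply/eqP.
apply: eq_bigl => w'; case: (F w' =P F w) => [/FG ->|]; first by rewrite eqxx.
by rewrite andbF.
Qed.

Lemma entropy_eq (U V : eqType) (F : T -> U) (G : T -> V) :
  (forall w w', F w = F w' <-> G w = G w') -> entropy p F = entropy p G.
Proof. by move=> FG; apply/le_anti/andP; split; apply: entropy_le => w w' /FG. Qed.

Lemma entropy_cst (U : eqType) (u : U) : entropy p (fun=> u) = 0.
Proof.
apply/le_anti; rewrite entropy_ge0 andbT /entropy.
rewrite big1 ?oppr0// => w _; rewrite /pval eqxx sum_p log2_1; exact: mulr0.
Qed.

(** An inequality, since x / 0 = 0 makes the sum vanish on a level set of probability zero. *)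
Lemma sum_class_le1 (U : eqType) (F : T -> U) (u : U) :
  \sum_(w | F w == u) p w / pval p F (F w) <= 1.
Proof.
rewrite (eq_bigr (fun w => p w / pval p F u)) => [|w /eqP -> //].
rewrite -mulr_suml -/(pval p F u).
by have [->|nz] := eqVneq (pval p F u) 0; rewrite ?mul0r// divff.
Qed.

(* The hypothesis says that, within each level set of G, q sums to at most one
   over the distinct values of F. *)
Lemma condEntropy_gibbs (U V : eqType) (F : T -> U) (G : T -> V) (q : T -> R) :
  (forall w, 0 < p w -> 0 < q w) ->
  (forall v, \sum_(w | G w == G v)
      p w * q w / pval p (fun w => (F w, G w)) (F w, G w) <= 1) ->
  condEntropy p F G <= - \sum_w p w * log2 (q w).
Proof.
move=> q0 q1; pose FG w := (F w, G w).
have FG0 w : 0 < p w -> 0 < pval p FG (FG w) by exact: pval_gt0.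
have G0 w : 0 < p w -> 0 < pval p G (G w) by exact: pval_gt0.
(* The ratio of the guess q to the true conditional probability of F given G. Its mean is at most 1,
   and log a <= (a - 1) / ln 2 then bounds the mean of its logarithm by 0. *)
pose a w := q w * pval p G (G w) / pval p FG (FG w).
have suma : \sum_w p w * a w <= 1.
  rewrite (eq_bigr (fun w => \sum_(v | G v == G w)
     p v * (p w * q w / pval p FG (FG w)))); last first.
    by move=> w _; rewrite /a -mulr_suml -/(pval p G (G w)); ring.
  rewrite (exchange_big_dep predT)//= -sum_p; apply: ler_sum => v _.
  rewrite -mulr_sumr ler_piMr//; apply: le_trans (q1 v).
  by rewrite le_eqVlt (eq_bigl (fun w => G w == G v)) ?eqxx// => w; exact: eq_sym.
have : \sum_w p w * log2 (a w) <= 0.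
  apply: (@le_trans _ _ (\sum_w p w * ((a w - 1) / ln 2))).
    apply: expect_le => w pw; apply: log2_le_subr1.
    by rewrite /a divr_gt0 ?mulr_gt0 ?q0 ?G0 ?FG0.
  under eq_bigr do rewrite mulrA mulrBr mulr1.
  rewrite -mulr_suml sumrB sum_p pmulr_lle0 ?invr_gt0 ?ln2_gt0//.
  by rewrite subr_le0.
rewrite (@expect_eq _ (fun w => log2 (q w) + log2 (pval p G (G w))
   - log2 (pval p FG (FG w)))); last first.
  by move=> w pw; rewrite log2_div ?FG0 ?mulr_gt0 ?q0 ?G0// log2M ?q0 ?G0.
under eq_bigr do rewrite mulrBr mulrDr.
rewrite sumrB big_split/= /condEntropy /entropy -/FG; lra.
Qed.

(** The guess is here a subprobability kernel. Within a level set of G, the sample points with F = u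
    have normalized weights summing to at most one, so they contribute at most Q u. *)
Lemma condEntropy_gibbs_fin (U : finType) (V : eqType) (F : T -> U) (G : T -> V)
    (Q : U -> V -> R) :
  (forall u v, 0 <= Q u v) ->
  (forall w, 0 < p w -> 0 < Q (F w) (G w)) ->
  (forall w, \sum_u Q u (G w) <= 1) ->
  condEntropy p F G <= - \sum_w p w * log2 (Q (F w) (G w)).
Proof.
move=> Q0 Qp Q1; apply: (condEntropy_gibbs Qp) => v.
rewrite (partition_big F predT)//=; apply: le_trans (Q1 v).
apply: ler_sum => u _.
have := sum_class_le1 (fun w => (F w, G w)) (u, G v).
move=> /(ler_wpM2l (Q0 u (G v))); rewrite mulr1; apply: le_trans.
rewrite mulr_sumr le_eqVlt; apply/orP; left; apply/eqP.
apply: eq_big => [w|w /andP[/eqP -> /eqP ->]]; first by rewrite xpair_eqE andbC.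
ring.
Qed.

(** Gibbs with P(A | C) as the guess for the law of A given (B, C). *)
Lemma condEntropy_le (U V V' : eqType) (A : T -> U) (B : T -> V) (C : T -> V') :
  condEntropy p A (fun w => (B w, C w)) <= condEntropy p A C.
Proof.
pose AC w := (A w, C w).
pose q w := pval p AC (AC w) / pval p C (C w).
have -> : condEntropy p A C = - \sum_w p w * log2 (q w).
  rewrite (@expect_eq _ (fun w => log2 (pval p AC (AC w)) - log2 (pval p C (C w)))).
    under eq_bigr do rewrite mulrBr.
    rewrite sumrB /condEntropy /entropy -/AC; lra.
  by move=> w pw; rewrite log2_div ?pval_gt0.
apply: condEntropy_gibbs => [w pw|v]; first by rewrite divr_gt0 ?pval_gt0.
set ABC := fun w => (A w, (B w, C w)).
(* P(A, C) is expanded over sample points u in order to exchange the sums: for fixed u, the w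
   involved form a single level set of (A, B, C). *)
rewrite (eq_bigr (fun w => \sum_(u | AC u == AC w)
    p u / pval p C (C v) * (p w / pval p ABC (ABC w)))); last first.
  move=> w /eqP[_ Cw]; rewrite -!mulr_suml -/(pval p AC (AC w)) /q Cw.
  by rewrite -Cw -/(ABC w); ring.
rewrite (exchange_big_dep (fun u => C u == C v))/=; last first.
  by move=> w u /eqP[_ <-] /eqP[_ ->].
apply: le_trans (_ : \sum_(u | C u == C v) p u / pval p C (C v) <= 1); last first.
  apply: le_trans (sum_class_le1 C (C v)); rewrite le_eqVlt.
  by apply/orP; left; apply/eqP; apply: eq_bigr => u /eqP ->.
apply: ler_sum => u /eqP Cu; rewrite -mulr_sumr ler_piMr ?divr_ge0 ?pval_ge0//.
apply: le_trans (sum_class_le1 ABC (A u, (B v, C v))).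
rewrite le_eqVlt; apply/orP; left; apply/eqP; apply: eq_bigl => w.
rewrite /AC /ABC !xpair_eqE Cu; case: (C w =P C v) => [->|_]; rewrite ?andbF//.
by rewrite eqxx !andbT andbC eq_sym.
Qed.

Lemma entropy_pair_le (U V : eqType) (A : T -> U) (B : T -> V) :
  entropy p (fun w => (A w, B w)) <= entropy p A + entropy p B.
Proof.
have := condEntropy_le A B (fun=> tt).
rewrite /condEntropy entropy_cst subr0.
rewrite (@entropy_eq _ _ _ (fun w => (A w, B w))); last first.
  by move=> w w'; split => [[-> ->]|[-> ->]].
rewrite (@entropy_eq _ _ (fun w => (B w, tt)) B); last first.
  by move=> w w'; split => [[->]|->].
rewrite (@entropy_eq _ _ (fun w => (A w, tt)) A); last first.
  by move=> w w'; split => [[->]|->].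
by rewrite lerBlDr.
Qed.

Lemma entropy_le_card (U : finType) (F : T -> U) (N : nat) :
  (#|U| <= N)%N -> (0 < N)%N -> entropy p F <= log2 N%:R.
Proof.
move=> UN N0.
have := @condEntropy_gibbs_fin _ _ F (fun=> tt) (fun _ _ => N%:R^-1).
rewrite /condEntropy entropy_cst subr0 (@entropy_eq _ _ (fun w => (F w, tt)) F);
  last by move=> w w'; split => [[->]|->].
rewrite -mulr_suml sum_p mul1r log2V ?ltr0n// opprK; apply => //.
- by move=> _ _; rewrite invr_gt0 ltr0n.
- by move=> _; rewrite sumr_const -[leLHS]mulr_natl ler_pdivrMr ?ltr0n// mul1r ler_nat.
Qed.

End FiniteEntropy.

(** * The memoryless source *)

Lemma prod_if (R : comPzRingType) (I : finType) (b : pred I) (F : I -> R) :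
  \prod_i (if b i then F i else 0) = if [forall i, b i] then \prod_i F i else 0.
Proof.
case: ifPn => [/forallP bT|/forallPn[i /negbTE bi]].
  by apply: eq_bigr => i _; rewrite bT.
by rewrite (bigD1 i)//= bi mul0r.
Qed.

Section Memoryless.
Variables (R : realType) (X Y W : finType).
Variables (PX : X -> R) (PYX : X -> Y -> R) (PWY : Y -> W -> R).
Hypotheses (hPX : is_pmf PX) (hPYX : forall x, is_pmf (PYX x)).
Hypothesis hPWY : forall y, is_pmf (PWY y).

Local Notation mu := (pXYW PX PYX PWY).
Local Notation muXY := (pXY PX PYX).

Lemma sum_pXYW (f : X -> Y -> R) :
  \sum_a mu a * f a.1.1 a.1.2 = \sum_xy muXY xy * f xy.1 xy.2.
Proof.
rewrite -(pair_bigA _ (fun xy w => mu (xy, w) * f xy.1 xy.2))/=.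
apply: eq_bigr => -[x y] _ /=; rewrite -mulr_suml /pXYW/= -mulr_sumr.
by rewrite (hPWY y).2 mulr1.
Qed.

Lemma pXY_pmf : is_pmf muXY.
Proof.
split=> [[x y]|]; first by rewrite mulr_ge0 ?hPX.1// (hPYX x).1.
rewrite -(pair_bigA _ (fun x y => muXY (x, y)))/= -hPX.2.
by apply: eq_bigr => x _; rewrite /pXY/= -mulr_sumr (hPYX x).2 mulr1.
Qed.

Lemma pXYW_pmf : is_pmf mu.
Proof.
split=> [[[x y] w]|].
  by rewrite !mulr_ge0 ?hPX.1 ?(hPYX x).1 ?(hPWY y).1.
have := sum_pXYW (fun _ _ => 1).
under eq_bigr do rewrite mulr1; move=> ->.
by under eq_bigr do rewrite mulr1; exact: pXY_pmf.2.
Qed.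

Section Block.
Variables (n mK : nat) (pK : 'I_mK -> R).
Hypothesis hpK : is_pmf pK.

Local Notation Om := (Omega X Y W n mK).
Local Notation P := (@pOmega R X Y W PX PYX PWY n mK pK).

Definition letter (o : Om) (t : 'I_n) : X * Y * W := (xof o t, yof o t, wof o t).

Definition upd (S : finType) (x : {ffun 'I_n -> S}) (t : 'I_n) (a : S) :=
  [ffun i => if i == t then a else x i].

Definition updO (o : Om) (t : 'I_n) (a : X * Y * W) : Om :=
  (kof o, (upd (xof o) t a.1.1, upd (yof o) t a.1.2, upd (wof o) t a.2)).

Lemma letter_updO o t a i : letter (updO o t a) i = if i == t then a else letter o i.
Proof.
by rewrite /letter /updO /xof /yof /wof/= !ffunE; case: ifP => // _; case: a => -[].
Qed.

Lemma Omega_eqP (o o' : Om) :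
  kof o = kof o' -> (forall i, letter o i = letter o' i) -> o = o'.
Proof.
case: o o' => k [[x y] w] [k' [[x' y'] w']]; rewrite /letter /kof /= => -> e.
by congr (_, (_, _, _)); apply/ffunP => i; have [] := e i.
Qed.

Lemma pOmegaE o : P o = pK (kof o) * \prod_t mu (letter o t).
Proof. by []. Qed.

Lemma sum_Omega (phi : 'I_mK -> R) (F : 'I_n -> X * Y * W -> R) :
  \sum_(o : Om) phi (kof o) * \prod_t F t (letter o t) =
  (\sum_k phi k) * \prod_t \sum_a F t a.
Proof.
rewrite bigA_distr_bigA big_distrlr/=.
(* [Omega] holds three sequences, whereas the product formula wants one sequence of triples; [h] is
   the bijection between the two. *)
pose h (o' : 'I_mK * {ffun 'I_n -> X * Y * W}) : Om :=
  (o'.1, ([ffun i => (o'.2 i).1.1], [ffun i => (o'.2 i).1.2], [ffun i => (o'.2 i).2])).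
have hE o' i : letter (h o') i = o'.2 i.
  by rewrite /letter /h /xof/yof/wof/= !ffunE; case: (o'.2 i) => -[].
rewrite (reindex h); last first.
  exists (fun o => (kof o, [ffun i => letter o i])) => [[k f]|o] _.
    by congr pair; apply/ffunP => i; rewrite ffunE hE.
  by apply: Omega_eqP => // i; rewrite hE ffunE.
rewrite -(pair_bigA _ (fun k f => phi (kof (h (k, f))) * \prod_t F t (letter (h (k, f)) t)))/=.
apply: eq_bigr => k _; apply: eq_bigr => f _; congr (_ * _).
by apply: eq_bigr => t _; rewrite hE.
Qed.

Lemma pOmega_pmf : is_pmf P.
Proof.
split=> [ o|].
  by rewrite pOmegaE mulr_ge0 ?hpK.1// prodr_ge0// => t _; exact: pXYW_pmf.1.
have := sum_Omega pK (fun _ a => mu a); rewrite hpK.2 mul1r.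
by rewrite [RHS]big1// => t _; exact: pXYW_pmf.2.
Qed.

Lemma pOmega_gt0 o : 0 < P o -> 0 < pK (kof o) /\ forall t, 0 < mu (letter o t).
Proof.
rewrite pOmegaE => Po; split=> [|t].
  rewrite lt_neqAle hpK.1 andbT eq_sym; apply: contraTneq Po => ->.
  by rewrite mul0r ltxx.
rewrite lt_neqAle pXYW_pmf.1 andbT eq_sym; apply: contraTneq Po => E.
by rewrite (bigD1 t)//= E mul0r mulr0 ltxx.
Qed.

(** The events whose probability has to be known exactly are boxes: one condition on the key and a
    separate one on each letter. Independence then gives a product. *)
Lemma pval_box (U : eqType) (F : Om -> U) (u : U) (phi : pred 'I_mK)
    (c : 'I_n -> pred (X * Y * W)) :
  (forall o, (F o == u) = phi (kof o) && [forall t, c t (letter o t)]) ->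
  pval P F u = (\sum_(k | phi k) pK k) * \prod_t \sum_(a | c t a) mu a.
Proof.
move=> Fu; rewrite /pval [in RHS]big_mkcond/=.
have -> : \prod_t \sum_(a | c t a) mu a = \prod_t \sum_a (if c t a then mu a else 0).
  by apply: eq_bigr => t _; rewrite big_mkcond.
rewrite -sum_Omega big_mkcond; apply: eq_bigr => o _; rewrite Fu prod_if.
by case: (phi _) => /=; rewrite ?mul0r//; case: ifP; rewrite ?mulr0.
Qed.

(* Exchanging the t-th letter of o with an independent copy preserves the joint law. *)
Lemma expect_letter (t : 'I_n) (phi : Om -> X * Y * W -> R) :
  (forall o a b, phi (updO o t a) b = phi o b) ->
  \sum_o P o * phi o (letter o t) = \sum_o P o * \sum_a mu a * phi o a.
Proof.
move=> hphi.
pose s (oa : Om * (X * Y * W)) := (updO oa.1 t oa.2, letter oa.1 t).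
have sK : involutive s.
  move=> [ o a]; rewrite /s/= letter_updO eqxx; congr pair.
  by apply: Omega_eqP => // i; rewrite !letter_updO; case: eqP => // ->.
have sP oa : P (s oa).1 * mu (s oa).2 = P oa.1 * mu oa.2.
  case: oa => o a /=; rewrite !pOmegaE [in LHS](bigD1 t)//= [in RHS](bigD1 t)//=.
  rewrite letter_updO eqxx (eq_bigr (fun i => mu (letter o i))); last first.
    by move=> i /negbTE it; rewrite letter_updO it.
  by rewrite /updO /kof/=; ring.
rewrite (eq_bigr (fun o => \sum_a P o * mu a * phi o (letter o t))); last first.
  by move=> o _; rewrite -mulr_suml -mulr_sumr pXYW_pmf.2 mulr1.
rewrite [RHS](eq_bigr (fun o => \sum_a P o * mu a * phi o a)); last first.
  by move=> o _; rewrite mulr_sumr; apply: eq_bigr => a _; rewrite mulrA.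
rewrite !pair_bigA/= (reindex_inj (inv_inj sK)); apply: eq_bigr => oa _.
by rewrite -/s sP; case: oa => o a /=; rewrite letter_updO eqxx hphi.
Qed.

Lemma pval_kof (V : eqType) (kap : 'I_mK -> V) (v : V) :
  pval P (fun o => kap (kof o)) v = pval pK kap v.
Proof.
rewrite (@pval_box _ _ _ (fun k => kap k == v) (fun _ _ => true)); last first.
  by move=> o; rewrite [X in _ && X](_ : _ = true) ?andbT//; apply/forallP.
by rewrite [X in _ * X]big1 ?mulr1// => t _; exact: pXYW_pmf.2.
Qed.

Lemma entropy_kof (V : eqType) (kap : 'I_mK -> V) :
  entropy P (fun o => kap (kof o)) = entropy pK kap.
Proof.
rewrite /entropy; congr (- _).
under eq_bigr do rewrite pval_kof pOmegaE mulrAC.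
rewrite (sum_Omega (fun k => pK k * log2 (pval pK kap (kap k))) (fun _ a => mu a)).
by rewrite [X in _ * X]big1 ?mulr1// => t _; exact: pXYW_pmf.2.
Qed.

(** [kap] and [pr] select what is kept of the key and of each letter. This covers H(K, X^n, W^n),
    H(K, W^n) and, with a constant [kap], the versions without key. *)
Lemma entropy_block (V : eqType) (B : eqType) (kap : 'I_mK -> V) (pr : X * Y * W -> B) :
  entropy P (fun o => (kap (kof o), [ffun t => pr (letter o t)])) =
  entropy pK kap + n%:R * entropy mu pr.
Proof.
pose F o := (kap (kof o), [ffun t => pr (letter o t)]).
have pvE o : pval P F (F o) =
    pval pK kap (kap (kof o)) * \prod_t pval mu pr (pr (letter o t)).
  rewrite (@pval_box _ _ _ (fun k => kap k == kap (kof o))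
    (fun t a => pr a == pr (letter o t)))// => o'.
  rewrite /F xpair_eqE; congr andb; apply/eqP/forallP => [/ffunP e t|e].
    by have := e t; rewrite !ffunE => ->.
  by apply/ffunP => t; rewrite !ffunE; exact/eqP.
rewrite /entropy.
rewrite (@expect_eq _ _ _ pOmega_pmf _ (fun o => log2 (pval pK kap (kap (kof o)))
    + \sum_t log2 (pval mu pr (pr (letter o t))))); last first.
  move=> o /pOmega_gt0[K0 m0]; rewrite -/(F o) pvE.
  rewrite log2M ?log2_prod ?pval_gt0//.
  - by move=> t; rewrite pval_gt0//; exact: pXYW_pmf.
  - by rewrite prodr_gt0// => t _; rewrite pval_gt0//; exact: pXYW_pmf.
under eq_bigr do rewrite mulrDr.
rewrite big_split/= opprD -/(entropy pK kap); congr (_ + _).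
  rewrite -(entropy_kof kap) /entropy; congr (- _); apply: eq_bigr => o _.
  by rewrite pval_kof.
under eq_bigr do rewrite mulr_sumr.
rewrite exchange_big/= mulrN; congr (- _).
rewrite (eq_bigr (fun=> \sum_a mu a * log2 (pval mu pr (pr a)))).
  by rewrite sumr_const card_ord -[LHS]mulr_natl.
move=> t _; rewrite (@expect_letter t (fun _ a => log2 (pval mu pr (pr a))))//.
by rewrite -mulr_suml pOmega_pmf.2 mul1r.
Qed.

Lemma entropy_block_nokey (B : eqType) (pr : X * Y * W -> B) :
  entropy P (fun o => [ffun t => pr (letter o t)]) = n%:R * entropy mu pr.
Proof.
have := entropy_block (fun=> tt) pr; rewrite (entropy_cst hpK) add0r => <-.
by apply: (entropy_eq pOmega_pmf) => o o'; split=> [->|[->]].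
Qed.

End Block.
End Memoryless.

(** * Scalar codes and the lower convex envelope *)

Lemma sum_delta (R : pzRingType) (I : finType) (i0 : I) (F : I -> R) :
  \sum_i (i == i0)%:R * F i = F i0.
Proof.
by rewrite (bigD1 i0)//= eqxx mul1r big1 ?addr0// => i /negbTE ->; rewrite mul0r.
Qed.

(** The witness 1 / (1 + sum of inverses) lies below every positive value, and is positive even if
    there is none. *)
Lemma positive_gap (R : realFieldType) (I : finType) (F : I -> R) :
  exists2 c, 0 < c & forall i, 0 < F i -> c <= F i.
Proof.
pose s := \sum_(i | 0 < F i) (F i)^-1.
have s0 : 0 <= s by apply: sumr_ge0 => i Fi; rewrite invr_ge0 ltW.
exists (1 + s)^-1 => [|i Fi]; first by rewrite invr_gt0 ltr_wpDr.
rewrite -[leRHS]invrK lef_pV2 ?posrE ?invr_gt0 ?ltr_wpDr//.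
rewrite /s (bigD1 i)//= addrCA lerDl addr_ge0// sumr_ge0// => j /andP[Fj _].
by rewrite invr_ge0 ltW.
Qed.

Section SingleLetter.
Variables (R : realType) (X Y Xh : finType).
Variables (PX : X -> R) (PYX : X -> Y -> R) (d : X -> Xh -> R).
Hypotheses (hPX : is_pmf PX) (hPYX : forall x, is_pmf (PYX x)).
Hypothesis hd : forall x xh, 0 <= d x xh.

Local Notation muXY := (pXY PX PYX).

(* A scalar code (f, g), with X itself as the message alphabet. *)
Local Notation code := ({ffun X -> X} * {ffun X * Y -> Xh})%type.

Definition crate (j : code) : R :=
  condEntropy muXY (fun xy => j.1 xy.1) (fun xy => xy.2).

Definition cdist (j : code) : R :=
  \sum_xy muXY xy * d xy.1 (j.2 (j.1 xy.1, xy.2)).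

(** Each message is renamed by a chosen preimage, so that codes over all alphabets live in one
    finite type. The default [x] is never reached, since [x] itself qualifies. *)
Definition code_of (S : eqType) (f : X -> S) (g : S -> Y -> Xh) : code :=
  ([ffun x => odflt x [pick x' | f x' == f x]], [ffun sy => g (f sy.1) sy.2]).

Lemma code_of1P (S : eqType) (f : X -> S) (g : S -> Y -> Xh) x x' :
  (code_of f g).1 x = (code_of f g).1 x' <-> f x = f x'.
Proof.
have fK z : f ((code_of f g).1 z) = f z.
  by rewrite ffunE; case: pickP => [z' /eqP|/(_ z)]//=; rewrite eqxx.
split=> [e|e]; first by rewrite -fK e fK.
rewrite !ffunE; have -> : [pick z | f z == f x] = [pick z | f z == f x'].
  by apply: eq_pick => z; rewrite e.
by case: pickP => // /(_ x'); rewrite eqxx.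
Qed.

Let muXY_pmf : is_pmf muXY := pXY_pmf hPX hPYX.

Lemma crate_code_of (S : eqType) (f : X -> S) (g : S -> Y -> Xh) :
  crate (code_of f g) = condEntropy muXY (fun xy => f xy.1) (fun xy => xy.2).
Proof.
rewrite /crate /condEntropy; congr (_ - _); apply: (entropy_eq muXY_pmf) => w w'.
by split=> -[e ->]; congr pair; apply/(code_of1P f g).
Qed.

Lemma cdist_code_of (S : eqType) (f : X -> S) (g : S -> Y -> Xh) :
  cdist (code_of f g) = \sum_xy muXY xy * d xy.1 (g (f xy.1) xy.2).
Proof.
apply: eq_bigr => -[x y] _; rewrite ffunE/=; congr (_ * d _ (g _ _)).
by rewrite ffunE; case: pickP => [z' /eqP|/(_ x)]//=; rewrite eqxx.
Qed.

Lemma crate_ge0 j : 0 <= crate j.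
Proof. by rewrite subr_ge0; apply: (entropy_le muXY_pmf) => w w' []. Qed.

Lemma cdist_ge0 j : 0 <= cdist j.
Proof. by apply: sumr_ge0 => xy _; rewrite mulr_ge0 ?muXY_pmf.1. Qed.

Local Notation rc := (rcSI PX PYX d).

Lemma rcSI_le D j : cdist j <= D -> (rc D <= (crate j)%:E)%E.
Proof.
move=> jD; apply: ereal_inf_lbound; exists #|X|, (fun x => enum_rank (j.1 x)),
  (fun s y => j.2 (enum_val s, y)); split=> //.
  by under eq_bigr do rewrite enum_rankK.
congr EFin; rewrite /crate /condEntropy; congr (_ - _).
apply: (entropy_eq muXY_pmf) => w w'.
by split=> [[-> ->]//|[/enum_rank_inj -> ->]].
Qed.

Lemma rcSI_lt D v : (rc D < v)%E -> exists2 j, cdist j <= D & ((crate j)%:E < v)%E.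
Proof.
move=> /ereal_inf_lt[_ [m [f [g [_ fgD ->]]]] lt_v].
by exists (code_of f g); rewrite ?cdist_code_of ?crate_code_of.
Qed.

Lemma rcSI_ge0 D : (0 <= rc D)%E.
Proof.
rewrite leNgt; apply/negP => /rcSI_lt[j _]; rewrite lte_fin ltNge.
by rewrite crate_ge0.
Qed.

(* The epigraph of the lower convex envelope, up to closure. *)
Definition achievable (D r : R) : Prop :=
  exists lam : code -> R, [/\ is_pmf lam, \sum_j lam j * cdist j <= D &
    \sum_j lam j * crate j <= r].

(** Pushes the weights forward along [j]. In the converse the index is a pair of a sample point and
    a time. *)
Lemma achievable_family (I : finType) (lam : I -> R) (j : I -> code) D r :
  is_pmf lam -> \sum_i lam i * cdist (j i) <= D ->
  \sum_i lam i * crate (j i) <= r -> achievable D r.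
Proof.
move=> hlam hD hr.
have push F : \sum_c pval lam j c * F c = \sum_i lam i * F (j i).
  rewrite [RHS](partition_big j predT)//=; apply: eq_bigr => c _.
  by rewrite mulr_suml; apply: eq_bigr => i /eqP ->.
exists (pval lam j); split; rewrite ?push//; split=> [c|]; first exact: pval_ge0.
by have := push (fun=> 1); under eq_bigr do rewrite mulr1; move=> ->;
  under eq_bigr do rewrite mulr1; exact: hlam.2.
Qed.

Lemma achievable_le D r D' r' :
  D <= D' -> r <= r' -> achievable D r -> achievable D' r'.
Proof.
by move=> hD hr [lam [h1 h2 h3]]; exists lam; split=> //;
  [exact: le_trans hD|exact: le_trans hr].
Qed.

Lemma lce_le D r : achievable D r -> (lce rc D <= r%:E)%E.
Proof.
move=> [lam [[lam0 lam1] lamD lamr]].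
(* The envelope admits strictly positive weights only, so the mixture is restricted to its
   support. *)
pose S := [set j | 0 < lam j].
have sumS (F : code -> R) : \sum_(i < #|S|) lam (enum_val i) * F (enum_val i) =
    \sum_j lam j * F j.
  rewrite -(big_enum_val (A := mem S) (fun j => lam j * F j)).
  rewrite big_mkcond; apply: eq_bigr => j _; rewrite inE.
  by case: ltgtP (lam0 j) => // <-; rewrite mul0r.
have sumS1 : \sum_(i < #|S|) lam (enum_val i) = 1.
  have := sumS (fun=> 1); under eq_bigr do rewrite mulr1; move=> ->.
  by under eq_bigr do rewrite mulr1.
(* The envelope requires mean distortion exactly D; the unspent part is added to every point, which
   only loosens its constraint. *)
pose slack := D - \sum_j lam j * cdist j.
apply: (@le_trans _ _ (\sum_(i < #|S|)
   ((lam (enum_val i))%:E * rc (cdist (enum_val i) + slack))%E)%E).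
  apply: ereal_inf_lbound; exists #|S|, (fun i => lam (enum_val i)),
    (fun i => cdist (enum_val i) + slack); split=> //.
    by move=> i; have := enum_valP i; rewrite inE.
  under eq_bigr do rewrite mulrDr.
  by rewrite big_split/= -mulr_suml sumS1 sumS mul1r /slack subrKC.
apply: (@le_trans _ _ (\sum_(i < #|S|) (lam (enum_val i) * crate (enum_val i))%:E)%E).
  apply: lee_sum => i _; rewrite EFinM lee_wpmul2l ?lee_fin//.
  by apply: rcSI_le; rewrite lerDl subr_ge0.
by rewrite sumEFin lee_fin sumS.
Qed.

Lemma lce_lt D v : (lce rc D < v%:E)%E -> achievable D v.
Proof.
move=> /ereal_inf_lt[_ [k [lam [Ds [lam0 lam1 lamD ->]]]]] lt_v.
(* One infinite value with a positive weight would make the whole sum +oo, against [lt_v]. *)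
have rc_fin i : exists r : R, rc (Ds i) = r%:E.
  case E : (rc (Ds i)) => [r| |]; [by exists r| |].
    suff /eqP e : (\sum_i ((lam i)%:E * rc (Ds i)))%E == +oo%E by rewrite e in lt_v.
    rewrite esum_eqy; last first.
      move=> i' _; rewrite gt_eqF// (lt_le_trans ltNy0)// mule_ge0 ?rcSI_ge0//.
      by rewrite lee_fin ltW.
    by apply/existsP; exists i; rewrite E gt0_muley ?lte_fin//=.
  by have := rcSI_ge0 (Ds i); rewrite E.
have [r rE] := choice rc_fin.
move: lt_v; under eq_bigr do rewrite rE -EFinM.
rewrite sumEFin lte_fin; set s := (X in X < v) => lt_v.
(* Each infimum may be missed by v - s, because the weights sum to one. *)
have jP i : exists j, cdist j <= Ds i /\ crate j < r i + (v - s).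
  have [|j jD jr] := @rcSI_lt (Ds i) (r i + (v - s))%:E.
    by rewrite rE lte_fin ltrDl subr_gt0.
  by exists j; rewrite -lte_fin.
have [j jE] := choice jP.
apply: (@achievable_family _ lam j) => //.
- by split=> // i; exact: ltW.
- by rewrite -lamD; apply: ler_sum => i _; rewrite ler_wpM2l ?(ltW (lam0 i))// (jE i).1.
- have -> : v = \sum_i lam i * (r i + (v - s)).
    under eq_bigr do rewrite mulrDr.
    by rewrite big_split/= -mulr_suml lam1 mul1r -/s subrKC.
  by apply: ler_sum => i _; rewrite ler_wpM2l ?(ltW (lam0 i))// ltW// (jE i).2.
Qed.

Lemma lceP D r :
  (lce rc D <= r%:E)%E <-> forall delta : R, 0 < delta -> achievable D (r + delta).
Proof.
split=> [le_r delta d0|ach].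
  by apply/lce_lt/(le_lt_trans le_r); rewrite lte_fin ltrDl.
by apply/lee_addgt0Pr => e e0; rewrite -EFinD lce_le//; exact: ach.
Qed.

(** Above the least distortion of a code, a small admixture of a code with distortion below D
    repairs the excess. At or below it, finiteness of the set of codes supplies a gap. *)
Lemma achievable_right_continuous D r :
  (forall delta : R, 0 < delta -> achievable (D + delta) (r + delta)) ->
  forall delta : R, 0 < delta -> achievable D (r + delta).
Proof.
move=> ach delta delta0.
have [[j0 j0D]|noj] := pselect (exists j, cdist j < D).
  have gap0 : 0 < D - cdist j0 by rewrite subr_gt0.
  set gap := D - cdist j0 in gap0.
  have cr0 := crate_ge0 j0.
  (* Chosen so that the rate excess e plus the cost (e / gap) * crate j0 of the admixture equals
     delta. *)
  pose e := delta / (1 + crate j0 / gap).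
  have den0 : 0 < 1 + crate j0 / gap by rewrite ltr_wpDr// divr_ge0// ltW.
  have e0 : 0 < e by rewrite divr_gt0.
  have [lam [[lam0 lam1] lamD lamr]] := ach e e0.
  (* The weight of [j0] that brings distortion D + e back to D: th * (e + gap) = e. *)
  pose th := e / (e + gap).
  have eg0 : 0 < e + gap by rewrite addr_gt0.
  have th0 : 0 <= th by rewrite divr_ge0 ?ltW.
  have th1 : th <= 1 by rewrite ler_pdivrMr// mul1r lerDl ltW.
  have mix (F : code -> R) : \sum_j ((1 - th) * lam j + th * (j == j0)%:R) * F j =
      (1 - th) * (\sum_j lam j * F j) + th * F j0.
    under eq_bigr do rewrite mulrDl -(mulrA (1 - th)) -(mulrA th).
    by rewrite big_split/= -!mulr_sumr sum_delta.
  exists (fun j => (1 - th) * lam j + th * (j == j0)%:R); split.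
  - split=> [j|]; first by rewrite addr_ge0// mulr_ge0// subr_ge0.
    have := mix (fun=> 1); under eq_bigr do rewrite mulr1.
    move=> ->; under eq_bigr do rewrite mulr1.
    by rewrite lam1; ring.
  - rewrite mix.
    have th1' : 0 <= 1 - th by rewrite subr_ge0.
    have := ler_wpM2l th1' lamD.
    have : th * (e + gap) = e by rewrite /th divfK// gt_eqF.
    by rewrite /gap; nra.
  - rewrite mix; set s := \sum_j _ in lamr *.
    have s0 : 0 <= s by apply: sumr_ge0 => j _; rewrite mulr_ge0// crate_ge0.
    have thgap : th <= e / gap.
      by rewrite /th ler_pM2l// lef_pV2 ?posrE// lerDr ltW.
    have := ler_wpM2r cr0 thgap.
    have : e + e / gap * crate j0 = delta.
      by rewrite -[RHS](divfK (lt0r_neq0 den0)) -/e; ring.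
    nra.
(* No code beats D. Either a single code at distortion D has a low enough rate, or the hypothesis is
   contradicted for a small e. *)
have cD j : D <= cdist j by rewrite leNgt; apply/negP => jD; apply: noj; exists j.
have [c c0 cP] := positive_gap (fun j => cdist j - D).
have [[j0 j0D j0r]|noj0] := pselect (exists2 j, cdist j = D & crate j <= r + delta).
  exists (fun j => (j == j0)%:R); split; rewrite ?sum_delta ?j0D//; split=> //.
  by have := sum_delta j0 (fun=> 1 : R); under eq_bigr do rewrite mulr1.
(* A Lagrange multiplier: codes with distortion above D exceed it by at least c, so the penalty M *
   c reaches r + delta. Averaging the bound [low] over a mixture for e gives r + delta <= r + delta
   / 2. *)
pose M := `|r + delta| / c.
have M0 : 0 <= M by rewrite divr_ge0// ltW.
have low j : r + delta <= crate j + M * (cdist j - D).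
  have [jD|jD] := eqVneq (cdist j) D.
    rewrite jD subrr mulr0 addr0 leNgt; apply/negP => jr; apply: noj0.
    by exists j => //; exact: ltW.
  have := cP j; rewrite subr_gt0 lt_neqAle eq_sym jD cD => /(_ isT).
  move=> /(ler_wpM2l M0); rewrite {1}/M divfK ?gt_eqF//.
  have := ler_norm (r + delta); have := crate_ge0 j; lra.
pose e := delta / (2 * (1 + M)).
have M1 : 0 < 1 + M by rewrite ltr_pwDl.
have e0 : 0 < e by rewrite divr_gt0// mulr_gt0.
have eE : e * (1 + M) = delta / 2 by rewrite /e; field; rewrite gt_eqF.
have [lam [[lam0 lam1] lamD lamr]] := ach e e0.
have : \sum_j lam j * (r + delta) <= \sum_j lam j * (crate j + M * (cdist j - D)).
  by apply: ler_sum => j _; rewrite ler_wpM2l.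
rewrite -mulr_suml lam1 mul1r.
have -> : \sum_j lam j * (crate j + M * (cdist j - D)) =
   \sum_j lam j * crate j + M * (\sum_j lam j * cdist j - D).
  rewrite -[X in M * (_ - X)]mul1r -lam1 mulr_suml -sumrB mulr_sumr -big_split/=.
  by apply: eq_bigr => j _; ring.
have : M * (\sum_j lam j * cdist j - D) <= M * e by rewrite ler_wpM2l// lerBlDl.
lra.
Qed.

End SingleLetter.

(** * Converse *)

Section Converse.
Variables (R : realType) (X Y W Xh : finType).
Variables (PX : X -> R) (PYX : X -> Y -> R) (PWY : Y -> W -> R) (d : X -> Xh -> R).
Hypotheses (hPX : is_pmf PX) (hPYX : forall x, is_pmf (PYX x)).
Hypothesis hPWY : forall y, is_pmf (PWY y).
Variables (n mK mS : nat) (pK : 'I_mK -> R).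
Hypothesis hpK : is_pmf pK.
Variable e : 'I_n -> 'I_mK -> {ffun 'I_n -> X} -> 'I_mS.
Hypothesis he : causal_enc e.

Local Notation mu := (pXYW PX PYX PWY).
Local Notation muXY := (pXY PX PYX).
Local Notation Om := (Omega X Y W n mK).
Local Notation P := (@pOmega R X Y W PX PYX PWY n mK pK).
Let P_pmf : is_pmf P := pOmega_pmf hPX hPYX hPWY n hpK.
Let mu_pmf : is_pmf mu := pXYW_pmf hPX hPYX hPWY.
Let muXY_pmf : is_pmf muXY := pXY_pmf hPX hPYX.

Local Notation C := (fun o : Om => (kof o, (yof o, wof o))).

(** Full length with [None] from position t on, so that the type does not depend on t; likewise for
    [Spast]. *)
Definition past (t : nat) (o : Om) : {ffun 'I_n -> option X} :=
  [ffun i : 'I_n => if (i < t)%N then Some (xof o i) else None].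

Definition Spast (t : nat) (o : Om) : {ffun 'I_n -> option 'I_mS} :=
  [ffun i : 'I_n => if (i < t)%N then Some (e i (kof o) (xof o)) else None].

(** The scalar encoder obtained by freezing all of [o] except its t-th source letter. *)
Definition loc_enc (o : Om) (t : 'I_n) (a : X) : 'I_mS :=
  e t (kof o) (upd (xof o) t a).

Lemma upd_upd (S : finType) (x : {ffun 'I_n -> S}) t a b :
  upd (upd x t a) t b = upd x t b.
Proof. by apply/ffunP => i; rewrite !ffunE; case: eqP. Qed.

Lemma upd_id (S : finType) (x : {ffun 'I_n -> S}) t : upd x t (x t) = x.
Proof. by apply/ffunP => i; rewrite !ffunE; case: eqP => // ->. Qed.

Lemma updO_id (o : Om) t : updO o t (letter o t) = o.
Proof. by case: o => k [[x y] w]; rewrite /updO /letter/= !upd_id. Qed.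

Lemma updO_updO (o : Om) t a b : updO (updO o t a) t b = updO o t b.
Proof. by rewrite /updO /kof /xof /yof /wof/= !upd_upd. Qed.

Lemma loc_enc_updO o t a b : loc_enc (updO o t a) t b = loc_enc o t b.
Proof. by rewrite /loc_enc /updO /xof /kof/= upd_upd. Qed.

Lemma loc_enc_id o t : loc_enc o t (xof o t) = e t (kof o) (xof o).
Proof. by rewrite /loc_enc upd_id. Qed.

Lemma past_eqP t o o' : past t o = past t o' <->
  forall i : 'I_n, (i < t)%N -> xof o i = xof o' i.
Proof.
split=> [/ffunP E i it|E]; first by have := E i; rewrite !ffunE it => -[].
by apply/ffunP => i; rewrite !ffunE; case: ifP => // /E ->.
Qed.

Lemma Spast_eqP t o o' : Spast t o = Spast t o' <->
  forall i : 'I_n, (i < t)%N -> e i (kof o) (xof o) = e i (kof o') (xof o').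
Proof.
split=> [/ffunP E i it|E]; first by have := E i; rewrite !ffunE it => -[].
by apply/ffunP => i; rewrite !ffunE; case: ifP => // /E ->.
Qed.

(** Degradedness enters here: P(w | y) factors out, and it cancels in the conditional law of X_t
    given (Y_t, W_t). *)
Lemma sum_letterYW (b : pred X) y w :
  \sum_(a | [&& a.1.2 == y, a.2 == w & b a.1.1]) mu a =
  PWY y w * \sum_(xy : X * Y | b xy.1 && (xy.2 == y)) muXY xy.
Proof.
have -> : \sum_(xy : X * Y | b xy.1 && (xy.2 == y)) muXY xy = \sum_(x | b x) muXY (x, y).
  rewrite -(pair_big b (fun y' => y' == y) (fun x y => muXY (x, y)))/=.
  by apply: eq_bigr => x _; rewrite big_pred1_eq.
rewrite mulr_sumr (reindex_onto (fun x => (x, y, w)) (fun a => a.1.1))/=.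
  by apply: eq_big => x; rewrite /= ?eqxx ?andbT// => _; rewrite mulrC.
by move=> [[x' y'] w']/= /and3P[/eqP -> /eqP -> _].
Qed.

(** Given the key and the past, causality makes the message a function of X_t alone. Given all the
    side information, the law of X_t depends on Y_t only, as the source is memoryless and
    degraded. *)
Lemma condEntropy_letter (t : 'I_n) :
  condEntropy P (fun o => e t (kof o) (xof o)) (fun o => (past t o, C o)) =
  \sum_o P o * condEntropy muXY (fun xy => loc_enc o t xy.1) (fun xy => xy.2).
Proof.
(* Both level sets are boxes: [b2] fixes the source letters before t, and [b1] also keeps letter t
   within its class under the local encoder. They differ at t only, so all other factors cancel. *)
pose b2 (o : Om) (i : 'I_n) x := (i < t)%N ==> (x == xof o i).
pose b1 (o : Om) (i : 'I_n) x :=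
  b2 o i x && ((i == t) ==> (loc_enc o t x == loc_enc o t (xof o t))).
pose c (b : Om -> 'I_n -> X -> bool) (o : Om) (i : 'I_n) (a : X * Y * W) :=
  [&& a.1.2 == yof o i, a.2 == wof o i & b o i a.1.1].
pose F2 o := (past t o, C o); pose F1 o := (e t (kof o) (xof o), F2 o).
have pv2 o : pval P F2 (F2 o) = pK (kof o) * \prod_i \sum_(a | c b2 o i a) mu a.
  rewrite (pval_box PX PYX PWY pK (phi := pred1 (kof o)) (c := c b2 o)) ?big_pred1_eq// => o'.
  apply/eqP/andP => [[/past_eqP px kE yE wE]|[/eqP kE /forallP cE]].
    split; first by rewrite kE; exact: eqxx.
    by apply/forallP => i; rewrite /c/= yE wE !eqxx/=; apply/implyP => /px ->.
  congr (_, (_, (_, _))) => //.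
  - by apply/past_eqP => i it; have /and3P[_ _ /implyP/(_ it)/eqP] := cE i.
  - by apply/ffunP => i; have /and3P[/eqP] := cE i.
  - by apply/ffunP => i; have /and3P[_ /eqP] := cE i.
have pv1 o : pval P F1 (F1 o) = pK (kof o) * \prod_i \sum_(a | c b1 o i a) mu a.
  rewrite (pval_box PX PYX PWY pK (phi := pred1 (kof o)) (c := c b1 o)) ?big_pred1_eq// => o'.
  have key : kof o' = kof o -> (forall i : 'I_n, (i < t)%N -> xof o' i = xof o i) ->
      e t (kof o') (xof o') = loc_enc o t (xof o' t).
    move=> kE xE; rewrite kE /loc_enc; apply: he => i; rewrite ffunE.
    by case: eqP => [->//|/eqP it]; rewrite leq_eqVlt val_eqE (negbTE it)/= => /xE.
  apply/eqP/andP => [[eE /past_eqP px kE yE wE]|[/eqP kE /forallP cE]].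
    split; first by rewrite kE; exact: eqxx.
    apply/forallP => i; rewrite /c/= yE wE !eqxx/= /b1; apply/andP; split.
      by apply/implyP => /px ->.
    by apply/implyP => /eqP ->; rewrite -key// eE loc_enc_id.
  have px (i : 'I_n) : (i < t)%N -> xof o' i = xof o i.
    by move=> it; have /and4P[_ _ /implyP/(_ it)/eqP] := cE i.
  congr (_, (_, (_, (_, _)))) => //.
  - rewrite key// -loc_enc_id.
    by have /and4P[_ _ _] := cE t; rewrite eqxx => /eqP.
  - exact/past_eqP.
  - by apply/ffunP => i; have /and3P[/eqP] := cE i.
  - by apply/ffunP => i; have /and3P[_ /eqP] := cE i.
pose fY (o : Om) := fun xy : X * Y => (loc_enc o t xy.1, xy.2).
pose phi (o : Om) (x : X) (y : Y) :=
  log2 (pval muXY (fY o) (fY o (x, y))) - log2 (pval muXY (fun xy => xy.2) y).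
have fY_upd o a : fY (updO o t a) = fY o.
  by apply/funext => xy; rewrite /fY loc_enc_updO.
have cond_phi o : \sum_a mu a * phi o a.1.1 a.1.2 =
    - condEntropy muXY (fun xy => loc_enc o t xy.1) (fun xy => xy.2).
  rewrite (sum_pXYW PX PYX hPWY (phi o)) /condEntropy /entropy.
  under eq_bigr do rewrite mulrBr.
  by rewrite sumrB opprB opprK [RHS]addrC; congr (_ - _); apply: eq_bigr => -[].
have main o : 0 < P o -> log2 (pval P F1 (F1 o)) - log2 (pval P F2 (F2 o)) =
    phi o (xof o t) (yof o t).
  move=> Po; have [k0 m0] := pOmega_gt0 hPX hPYX hPWY hpK Po.
  have pos (b : Om -> 'I_n -> X -> bool) i : b o i (xof o i) -> 0 < \sum_(a | c b o i a) mu a.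
    move=> bx; rewrite (bigD1 (letter o i))/=; last by rewrite /c/= !eqxx.
    by rewrite ltr_wpDr ?m0// sumr_ge0// => a _; exact: mu_pmf.1.
  have pos2 i : 0 < \sum_(a | c b2 o i a) mu a.
    by apply: pos; apply/implyP.
  have pos1 i : 0 < \sum_(a | c b1 o i a) mu a.
    by apply: pos; apply/andP; split; apply/implyP => // /eqP ->.
  rewrite pv1 pv2 !log2M ?prodr_gt0// !log2_prod// opprD addrACA subrr add0r.
  rewrite (bigD1 t)//= [X in _ - X](bigD1 t)//=.
  rewrite (eq_bigr (fun i => log2 (\sum_(a | c b2 o i a) mu a))); last first.
    move=> i /negbTE it; congr log2; apply: eq_bigl => a.
    by rewrite /c /b1 it andbT.
  rewrite opprD addrACA subrr addr0.
  have c2 : \sum_(a | c b2 o t a) mu a =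
      PWY (yof o t) (wof o t) * pval muXY (fun xy => xy.2) (yof o t).
    rewrite /pval -(sum_letterYW predT); apply: eq_bigl => a.
    by rewrite /c /b2 ltnn.
  have c1 : \sum_(a | c b1 o t a) mu a =
      PWY (yof o t) (wof o t) * pval muXY (fY o) (fY o (xof o t, yof o t)).
    rewrite /pval -(sum_letterYW (fun x => loc_enc o t x == loc_enc o t (xof o t))).
    by apply: eq_bigl => a; rewrite /c /b1 /b2 ltnn eqxx.
  have := pos2 t; have := pos1 t; rewrite c1 c2.
  have W0 := (hPWY (yof o t)).1 (wof o t).
  move=> h1 h2.
  have {}W0 : 0 < PWY (yof o t) (wof o t).
    by rewrite lt_neqAle W0 andbT; apply: contraTneq h1 => <-; rewrite mul0r ltxx.
  move: h1 h2; rewrite !pmulr_rgt0// => h1 h2.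
  by rewrite !log2M// opprD addrACA subrr add0r.
transitivity (- \sum_o P o * phi o (xof o t) (yof o t)).
  rewrite -(expect_eq P_pmf main); under [in RHS]eq_bigr do rewrite mulrBr.
  by rewrite sumrB opprB addrC /condEntropy /entropy opprK.
(* The local encoder ignores the t-th letter of [o], so that letter may be replaced by an
   independent copy. *)
rewrite (expect_letter hPX hPYX hPWY pK (phi := fun o a => phi o a.1.1 a.1.2)); last first.
  by move=> o a b; rewrite /phi fY_upd.
rewrite -sumrN; apply: eq_bigr => o _.
by rewrite cond_phi mulrN opprK.
Qed.

(** Chain rule by telescoping. Given K, x^{t-1} determines S^{t-1} by causality, so conditioning on
    it instead can only lower each term. *)
Lemma condEntropy_causal_ge :
  \sum_(t < n) \sum_o P o *
     condEntropy muXY (fun xy => loc_enc o t xy.1) (fun xy => xy.2) <=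
  condEntropy P (Sseq e) C.
Proof.
pose a m := entropy P (fun o => (Spast m o, C o)).
have -> : condEntropy P (Sseq e) C = a n - a 0.
  rewrite /condEntropy /a; congr (_ - _); apply: (entropy_eq P_pmf) => o o'.
    split=> [[/ffunP E -> -> ->]|[/Spast_eqP E -> -> ->]]; congr pair.
      by apply/Spast_eqP => i _; have := E i; rewrite !ffunE.
    by apply/ffunP => i; rewrite !ffunE; exact: E.
  by split=> -[kE yE wE]; rewrite kE yE wE.
rewrite -(telescope_sumr a (leq0n n)) big_mkord; apply: ler_sum => t _.
rewrite -condEntropy_letter.
pose B o := (Spast t o, C o).
have := condEntropy_le P_pmf (fun o => e t (kof o) (xof o)) (past t) B.
rewrite /condEntropy /a.
have SB o o' : past t o = past t o' -> C o = C o' -> Spast t o = Spast t o'.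
  move=> /past_eqP px [kE _ _]; apply/Spast_eqP => i it; rewrite kE; apply: he => j ji.
  by apply: px; exact: leq_ltn_trans it.
rewrite (entropy_eq P_pmf (F := fun o => (e t (kof o) (xof o), (past t o, B o)))
   (G := fun o => (e t (kof o) (xof o), (past t o, C o)))); last first.
  move=> o o'; split=> [[-> -> _ -> -> ->]//|[eE pE kE yE wE]].
  by rewrite /B eE (SB _ o')// ?pE kE yE wE.
rewrite (entropy_eq P_pmf (F := fun o => (past t o, B o))
   (G := fun o => (past t o, C o))); last first.
  move=> o o'; split=> [[-> _ -> -> ->]//|[pE kE yE wE]].
  by rewrite /B (SB _ o')// ?pE kE yE wE.
rewrite (entropy_eq P_pmf (F := fun o => (e t (kof o) (xof o), B o))
   (G := fun o => (Spast t.+1 o, C o)))// => o o'.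
split=> [[eE /Spast_eqP sE -> -> ->]|[/Spast_eqP sE kE yE wE]].
  congr pair; apply/Spast_eqP => i; rewrite ltnS leq_eqVlt => /orP[/eqP/val_inj ->//|].
  exact: sE.
congr pair; [exact: sE|rewrite /B kE yE wE; congr pair].
by apply/Spast_eqP => i it; rewrite sE// ltnS ltnW.
Qed.

Section Distortion.
Variable g : 'I_n -> 'I_mK -> {ffun 'I_n -> 'I_mS} -> {ffun 'I_n -> Y} -> Xh.
Hypothesis hg : causal_dec g.

Definition loc_dec (o : Om) (t : 'I_n) (s : 'I_mS) (y : Y) : Xh :=
  g t (kof o) (upd (Sseq e o) t s) (upd (yof o) t y).

Lemma distortion_letter (t : 'I_n) :
  \sum_o P o * d (xof o t) (g t (kof o) (Sseq e o) (yof o)) =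
  \sum_o P o * \sum_xy muXY xy * d xy.1 (loc_dec o t (loc_enc o t xy.1) xy.2).
Proof.
pose phi (o : Om) (a : X * Y * W) :=
  d a.1.1 (g t (kof o) (Sseq e (updO o t a)) (yof (updO o t a))).
transitivity (\sum_o P o * phi o (letter o t)).
  by apply: eq_bigr => o _; rewrite /phi updO_id.
rewrite (expect_letter hPX hPYX hPWY pK); last first.
  by move=> o a b; rewrite /phi updO_updO.
apply: eq_bigr => o _; congr (_ * _).
rewrite -(sum_pXYW PX PYX hPWY
  (fun x y => d x (loc_dec o t (loc_enc o t x) y))); apply: eq_bigr => a _.
(* Resampling x_t may alter every message from time t on. The earlier ones are fixed by [he], and
   [hg] hides the later ones. *)
congr (_ * d _ _); apply: hg => i it; split; last by rewrite /yof/= ffunE.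
rewrite !ffunE; case: eqP => [->//|/eqP ne].
apply: he => j ji; rewrite ffunE; case: eqP => // jt.
by move: ne; rewrite -val_eqE eqn_leq it -jt ji.
Qed.

Lemma converse_block : (0 < n)%N ->
  achievable PX PYX d
    ((\sum_(t < n) \sum_o P o * d (xof o t) (g t (kof o) (Sseq e o) (yof o))) / n%:R)
    (condEntropy P (Sseq e) C / n%:R).
Proof.
move=> n0; have nR : 0 < n%:R :> R by rewrite ltr0n.
pose J (ot : Om * 'I_n) := code_of (loc_enc ot.1 ot.2) (loc_dec ot.1 ot.2).
have swap (F : Om -> 'I_n -> R) :
    \sum_(ot : Om * 'I_n) P ot.1 / n%:R * F ot.1 ot.2 = (\sum_t \sum_o P o * F o t) / n%:R.
  rewrite -(pair_bigA _ (fun o t => P o / n%:R * F o t)) exchange_big mulr_suml/=.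
  by apply: eq_bigr => t _; rewrite mulr_suml; apply: eq_bigr => o _; ring.
apply: (@achievable_family _ _ _ _ _ _ _ _ (fun ot => P ot.1 / n%:R) J).
- split=> [ot|]; first by rewrite divr_ge0// P_pmf.1.
  have := swap (fun _ _ => 1); under eq_bigr do rewrite mulr1.
  move=> ->; rewrite (eq_bigr (fun=> 1)).
    by rewrite sumr_const card_ord divff// gt_eqF.
  by move=> t _; under eq_bigr do rewrite mulr1; exact: P_pmf.2.
- rewrite (swap (fun o t => cdist PX PYX d (J (o, t)))) ler_pM2r ?invr_gt0//.
  apply: ler_sum => t _; rewrite distortion_letter.
  by under eq_bigr do rewrite cdist_code_of.
- rewrite (swap (fun o t => crate PX PYX (J (o, t)))) ler_pM2r ?invr_gt0//.
  apply: le_trans condEntropy_causal_ge; apply: ler_sum => t _.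
  by under eq_bigr do rewrite crate_code_of//.
Qed.

End Distortion.

(** * Fano's inequality and bounds on the equivocation *)

Section Messages.
Variable Z : 'I_mK -> {ffun 'I_n -> X} -> seq bool.
Variable gZ : 'I_mK -> {ffun 'I_n -> Y} -> seq bool -> {ffun 'I_n -> 'I_mS}.

Local Notation Zo := (fun o : Om => Z (kof o) (xof o)).
Local Notation Perr :=
  (\sum_(o : Om | Sseq e o != gZ (kof o) (yof o) (Zo o)) P o).

(** Gibbs with half the mass on the decoder's output and half uniform over the message sequences
    possible under the key. A correct output costs at most 1 bit, a wrong one 1 + n log |X|; hence
    no binary entropy term. *)
Lemma fano : condEntropy P (Sseq e) (fun o => (Zo o, C o)) <=
  1 + Perr * (n%:R * log2 #|X|%:R).
Proof.
pose Sk k x : {ffun 'I_n -> 'I_mS} := [ffun t => e t k x].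
pose N := #|{ffun 'I_n -> X}|.
have X0 := pmf_card_gt0 hPX.
have N0 : 0 < N%:R :> R by rewrite ltr0n /N card_ffun card_ord expn_gt0 X0.
have logN : log2 N%:R = n%:R * log2 #|X|%:R :> R.
  rewrite /N card_ffun card_ord natrX /log2 lnXn ?ltr0n//.
  by rewrite -[X in X / _]mulr_natl mulrA.
rewrite -logN.
pose Q u (v : seq bool * ('I_mK * ({ffun 'I_n -> Y} * {ffun 'I_n -> W}))) : R :=
  (u == gZ v.2.1 v.2.2.1 v.1)%:R / 2 +
  (u \in [set Sk v.2.1 x | x : {ffun 'I_n -> X}])%:R / N%:R / 2.
have Sin (o : Om) : Sseq e o \in [set Sk (kof o) x | x : {ffun 'I_n -> X}].
  by apply/imsetP; exists (xof o).
have N0' := N0; rewrite -invr_gt0 in N0'.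
apply: le_trans (condEntropy_gibbs_fin P_pmf (Q := Q) _ _ _) _.
- by move=> u v; rewrite addr_ge0// !divr_ge0.
- by move=> o _; rewrite /Q/= Sin mul1r ltr_wpDl// ?divr_ge0// divr_gt0.
- move=> o; rewrite /Q/= big_split/= -!mulr_suml.
  have -> : \sum_u (u == gZ (kof o) (yof o) (Zo o))%:R = 1 :> R.
    have := sum_delta (gZ (kof o) (yof o) (Zo o)) (fun=> 1 : R).
    by under eq_bigr do rewrite mulr1.
  set im := [set Sk (kof o) x | x : {ffun 'I_n -> X}].
  have -> : \sum_u (u \in im)%:R = #|im|%:R :> R.
    rewrite -sum1_card natr_sum [RHS]big_mkcond/=.
    by apply: eq_bigr => u _; case: (u \in im).
  have : #|im|%:R / N%:R <= 1 :> R.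
    by rewrite ler_pdivrMr// mul1r ler_nat /N /im leq_imset_card.
  lra.
have logN0 : 0 <= log2 N%:R :> R.
  by rewrite -(log2_1 R) ler_log2// ler1n -(ltr0n R).
have -> : 1 + Perr * log2 N%:R =
    \sum_o P o * (1 + (Sseq e o != gZ (kof o) (yof o) (Zo o))%:R * log2 N%:R).
  under [RHS]eq_bigr do rewrite mulrDr mulr1 mulrA.
  rewrite big_split/= -mulr_suml P_pmf.2 big_mkcond/=; congr (_ + _ * _).
  by apply: eq_bigr => o _; case: (_ != _); rewrite ?mulr1 ?mulr0.
rewrite -sumrN; under eq_bigr do rewrite -mulrN.
have log2_2 : log2 2 = 1 :> R by rewrite -[X in log2 X]expr1 log2X.
apply: (expect_le P_pmf) => o Po; rewrite /Q/= Sin mul1r.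
case: eqP => [_|_] /=.
  rewrite mul1r mul0r addr0 lerNl; apply: (@le_trans _ _ (log2 2^-1)).
    by rewrite log2V// log2_2.
  by rewrite ler_log2// lerDl divr_ge0// ltW.
rewrite mul0r add0r mul1r -invfM log2V ?mulr_gt0// opprK log2M// log2_2.
by rewrite addrC.
Qed.

Lemma entropy_message_ge :
  condEntropy P (Sseq e) C - (1 + Perr * (n%:R * log2 #|X|%:R)) <= condEntropy P Zo C.
Proof.
have := fano; rewrite /condEntropy.
have : entropy P (fun o => (Sseq e o, C o)) <= entropy P (fun o => (Sseq e o, (Zo o, C o))).
  by apply: (entropy_le P_pmf) => o o' [-> _ -> -> ->].
lra.
Qed.

Lemma condEntropy_message_le : condEntropy P Zo C <= entropy P Zo.
Proof. by have := entropy_pair_le P_pmf Zo C; rewrite /condEntropy; lra. Qed.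

Lemma entropy_keyXW :
  entropy P (fun o => (kof o, (xof o, wof o))) =
  entropy P (@kof X Y W n mK) + n%:R * entropy mu (fun a => (a.1.1, a.2)).
Proof.
rewrite -[entropy P (@kof _ _ _ _ _)]/(entropy P (fun o => id (kof o))).
rewrite (entropy_kof hPX hPYX hPWY) -(entropy_block hPX hPYX hPWY n hpK).
apply: (entropy_eq P_pmf) => o o'; split=> [[-> xE wE]|[-> /ffunP E]]; congr pair.
  by apply/ffunP => t; rewrite !ffunE/= xE wE.
by congr pair; apply/ffunP => t; have := E t; rewrite !ffunE/= => -[].
Qed.

Lemma entropy_keyW :
  entropy P (fun o => (kof o, wof o)) =
  entropy P (@kof X Y W n mK) + n%:R * entropy mu (fun a => a.2).
Proof.
rewrite -[entropy P (@kof _ _ _ _ _)]/(entropy P (fun o => id (kof o))).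
rewrite (entropy_kof hPX hPYX hPWY) -(entropy_block hPX hPYX hPWY n hpK).
apply: (entropy_eq P_pmf) => o o'; split=> [[-> wE]|[-> /ffunP E]]; congr pair.
  by apply/ffunP => t; rewrite !ffunE/= wE.
by apply/ffunP => t; have := E t; rewrite !ffunE.
Qed.

Lemma equivocation_le_source :
  condEntropy P (@xof X Y W n mK) (fun o => (wof o, Zo o)) <=
  n%:R * HXgW PX PYX PWY.
Proof.
have := condEntropy_le P_pmf (@xof X Y W n mK) Zo (@wof X Y W n mK).
have -> : condEntropy P (@xof X Y W n mK) (fun o => (Zo o, wof o)) =
    condEntropy P (@xof X Y W n mK) (fun o => (wof o, Zo o)).
  rewrite /condEntropy; congr (_ - _).
    by apply: (entropy_eq P_pmf) => o o'; split=> -[-> -> ->].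
  by apply: (entropy_eq P_pmf) => o o'; split=> -[-> ->].
move=> /le_trans; apply; rewrite le_eqVlt; apply/orP; left; apply/eqP.
rewrite /HXgW /condEntropy mulrBr; congr (_ - _);
  rewrite -(entropy_block_nokey hPX hPYX hPWY n hpK);
  apply: (entropy_eq P_pmf) => o o'; split.
- by move=> [xE wE]; apply/ffunP => t; rewrite !ffunE/= xE wE.
- by move=> /ffunP E; congr pair; apply/ffunP => t; have := E t; rewrite !ffunE/= => -[].
- by move=> wE; apply/ffunP => t; rewrite !ffunE/= wE.
- by move=> /ffunP E; apply/ffunP => t; have := E t; rewrite !ffunE.
Qed.

(** Since Z is a function of (K, X^n), H(X^n, W^n, Z) <= H(K) + n H(X, W). Since K and W^n are
    independent, H(W^n, Z) >= H(K, W^n, Z) - H(K) = n H(W) + H(Z | K, W^n). Subtract, then condition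
    on Y^n as well. *)
Lemma equivocation_le_key :
  condEntropy P (@xof X Y W n mK) (fun o => (wof o, Zo o)) <=
  entropy P (@kof X Y W n mK) + n%:R * HXgW PX PYX PWY - condEntropy P Zo C.
Proof.
have h1 : entropy P (fun o => (xof o, (wof o, Zo o))) <=
    entropy P (fun o => (kof o, (xof o, wof o))).
  by apply: (entropy_le P_pmf) => o o' [-> -> ->].
have h2 : entropy P (fun o => (kof o, (wof o, Zo o))) <=
    entropy P (@kof X Y W n mK) + entropy P (fun o => (wof o, Zo o)).
  exact: (entropy_pair_le P_pmf).
have h3 : condEntropy P Zo C <=
    entropy P (fun o => (kof o, (wof o, Zo o))) - entropy P (fun o => (kof o, wof o)).
  have := condEntropy_le P_pmf Zo (@yof X Y W n mK) (fun o => (kof o, wof o)).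
  rewrite /condEntropy.
  rewrite (entropy_eq P_pmf (F := fun o => (Zo o, (yof o, (kof o, wof o))))
    (G := fun o => (Zo o, C o))); last by move=> o o'; split=> -[-> -> -> ->].
  rewrite (entropy_eq P_pmf (F := fun o => (yof o, (kof o, wof o)))
    (G := C)); last by move=> o o'; split=> -[-> -> ->].
  rewrite (entropy_eq P_pmf (F := fun o => (Zo o, (kof o, wof o)))
    (G := fun o => (kof o, (wof o, Zo o))))//.
  by move=> o o'; split=> -[-> -> ->].
move: h1 h2 h3; rewrite entropy_keyXW entropy_keyW /HXgW /condEntropy !mulrBr; lra.
Qed.

End Messages.
End Converse.

(** * Direct part *)

(** Rounding each share n * lam i up leaves at least n slots, and the surplus ones are dropped. One
    schedule serves rate and distortion at once, with an error independent of n. *)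
Lemma time_sharing (R : realType) (J : finType) (lam : J -> R) (n : nat) :
  is_pmf lam -> exists j : 'I_n -> J, forall F : J -> R, (forall i, 0 <= F i) ->
    \sum_t F (j t) <= n%:R * (\sum_i lam i * F i) + \sum_i F i.
Proof.
move=> [lam0 lam1].
pose c i := (Num.truncn (n%:R * lam i)).+1.
have c_ge i : n%:R * lam i <= (c i)%:R by rewrite ltW// truncnS_gt.
have c_le i : (c i)%:R <= n%:R * lam i + 1.
  by rewrite -[(c i)%:R]natr1 lerD2r truncn_le// mulr_ge0.
pose T := {i : J & 'I_(c i)}.
have sumT (F : J -> R) : \sum_(u : T) F (tag u) = \sum_i (c i)%:R * F i.
  rewrite (eq_bigr (fun i => \sum_(k < c i) F i)); last first.
    by move=> i _; rewrite sumr_const card_ord -[RHS]mulr_natl.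
  by rewrite (sig_big_dep _ _ (fun i (k : 'I_(c i)) => F i)).
have nT : (n <= #|{: T}|)%N.
  rewrite -(ler_nat R) -sum1_card natr_sum (sumT (fun=> 1)).
  under eq_bigr do rewrite mulr1.
  apply: (@le_trans _ _ (\sum_i n%:R * lam i)); last exact: ler_sum.
  by rewrite -mulr_sumr lam1 mulr1.
pose io (t : 'I_n) : T := enum_val (widen_ord nT t).
have io_inj : injective io.
  by move=> t t' /enum_val_inj/(congr1 val)/= /val_inj.
exists (fun t => tag (io t)) => F F0.
apply: (@le_trans _ _ (\sum_(u : T) F (tag u))).
  rewrite [leRHS](bigID (mem [set io t | t : 'I_n]))/= big_imset/=; last first.
    by move=> t t' _ _; exact: io_inj.
  by rewrite (eq_bigl predT) ?lerDl ?sumr_ge0// => t; rewrite inE.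
rewrite sumT mulr_sumr -big_split/=; apply: ler_sum => i _.
by rewrite mulrA -[X in _ + X]mul1r -mulrDl ler_wpM2r.
Qed.

(** * Random binning with side information *)

Section Binning.
Variables (R : realType) (T U V B : finType) (p : T -> R).
Hypothesis hp : is_pmf p.
Variables (S : T -> U) (side : T -> V) (A : V -> pred U).

(** Overwriting b s by an arbitrary c is injective on colliding b, because b s can be read off at
    s'. *)
Lemma collision_card (s s' : U) : s != s' ->
  (#|[set b : {ffun U -> B} | b s == b s']| * #|B| <= #|{ffun U -> B}|)%N.
Proof.
move=> ne; set E := [set b | _].
pose h (bc : {ffun U -> B} * B) := [ffun u => if u == s then bc.2 else bc.1 u].
rewrite -[#|B|]cardsT -cardsX -(card_in_imset (f := h)) ?max_card//.
move=> [b c] [b' c']; rewrite !inE/= !andbT => /eqP bE /eqP bE' /ffunP hE.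
have := hE s; rewrite !ffunE eqxx/= => ->; congr pair.
have off u : u != s -> b u = b' u by move=> us; have := hE u; rewrite !ffunE (negbTE us).
apply/ffunP => u; have [->|/off//] := eqVneq u s.
by rewrite bE bE' off// eq_sym.
Qed.

Lemma exists_le_average (I : finType) (f : I -> R) (c : R) :
  (0 < #|I|)%N -> \sum_i f i <= #|I|%:R * c -> exists i, f i <= c.
Proof.
move=> /card_gt0P[i0 _] fc; apply: contrapT => nex.
have lt i : c < f i by rewrite ltNge; apply/negP => fi; apply: nex; exists i.
move: fc; rewrite leNgt => /negP; apply.
rewrite [ltLHS]mulr_natl -sumr_const.
by apply: ltr_sum => //; apply/hasP; exists i0; rewrite // mem_index_enum.
Qed.

(* Average the number of typical confusable messages over all binnings b. *)
Lemma random_binning (M : R) : (0 < #|B|)%N ->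
  (forall v, #|[set s | A v s]|%:R <= M) ->
  exists (b : U -> B) (dec : V -> B -> U),
    \sum_(w | S w != dec (side w) (b (S w))) p w <=
    \sum_(w | ~~ A (side w) (S w)) p w + M / #|B|%:R.
Proof.
move=> B0 AM; have BR : 0 < #|B|%:R :> R by rewrite ltr0n.
have /card_gt0P[w0 _] := pmf_card_gt0 hp.
pose F := {ffun U -> B}.
pose conf (b : F) w : R := \sum_(s in [set s | A (side w) s] | s != S w) (b s == b (S w))%:R.
have [||b hb] := @exists_le_average F (fun b => \sum_w p w * conf b w) (M / #|B|%:R).
- by rewrite card_ffun expn_gt0 B0.
- rewrite exchange_big/=.
  apply: (@le_trans _ _ (\sum_w p w * (#|F|%:R * (M / #|B|%:R)))); last first.
    by rewrite -mulr_suml hp.2 mul1r.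
  apply: ler_sum => w _.
  rewrite -mulr_sumr ler_wpM2l ?hp.1// exchange_big/=.
  apply: (@le_trans _ _ (\sum_(s in [set s | A (side w) s]) (#|F|%:R / #|B|%:R))).
    rewrite [leRHS](bigID (fun s => s != S w))/= -[leLHS]addr0 lerD//; last first.
      by apply: sumr_ge0 => s _; rewrite divr_ge0.
    apply: ler_sum => s /andP[_ ne]; rewrite ler_pdivlMr//.
    have := collision_card ne; rewrite -(ler_nat R) natrM; apply: le_trans.
    rewrite ler_pM2r// -sum1_card natr_sum [leRHS]big_mkcond/=.
    by apply: ler_sum => b _; rewrite inE; case: eqP.
  rewrite sumr_const -[leLHS]mulr_natl mulrCA ler_wpM2l//.
  by rewrite ler_wpM2r ?invr_ge0.
(* The default occurs for a true message only if that message is atypical, which the first error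
   term counts. A wrong pick makes [conf] at least 1. *)
exists b, (fun v beta => odflt (S w0) [pick s | A v s && (b s == beta)]).
apply: le_trans (lerD (lexx _) hb).
rewrite [leLHS]big_mkcond [X in _ <= X + _]big_mkcond -big_split/=; apply: ler_sum => w _.
have conf0 : 0 <= conf b w by apply: sumr_ge0.
case: ifPn => [|_]; last first.
  by rewrite addr_ge0 ?mulr_ge0 ?hp.1//; case: ifP => // _; exact: hp.1.
case: pickP => [s /andP[As /eqP bs]/= ne|none _]; last first.
  have := none (S w); rewrite eqxx andbT => ->/=.
  by rewrite lerDl mulr_ge0 ?hp.1.
apply: (@le_trans _ _ (p w * conf b w)).
  rewrite ler_peMr ?hp.1// /conf (bigD1 s)/=; last by rewrite inE As eq_sym.
  by rewrite bs eqxx lerDl sumr_ge0.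
by rewrite lerDr; case: ifP => // _; exact: hp.1.
Qed.

End Binning.

Section Direct.
Variables (R : realType) (X Y W Xh : finType).
Variables (PX : X -> R) (PYX : X -> Y -> R) (PWY : Y -> W -> R) (d : X -> Xh -> R).
Hypotheses (hPX : is_pmf PX) (hPYX : forall x, is_pmf (PYX x)).
Hypothesis hPWY : forall y, is_pmf (PWY y).

Local Notation mu := (pXYW PX PYX PWY).
Local Notation muXY := (pXY PX PYX).
Local Notation code := ({ffun X -> X} * {ffun X * Y -> Xh})%type.
Let mu_pmf : is_pmf mu := pXYW_pmf hPX hPYX hPWY.
Let muXY_pmf : is_pmf muXY := pXY_pmf hPX hPYX.

Definition condp (c : code) (s : 'I_#|X|) (y : Y) : R :=
  pval muXY (fun xy => (enum_rank (c.1 xy.1), xy.2)) (s, y) /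
  pval muXY (fun xy => xy.2) y.

Lemma condp_ge0 c s y : 0 <= condp c s y.
Proof. by rewrite divr_ge0// pval_ge0. Qed.

Lemma sum_condp_le1 c y : \sum_s condp c s y <= 1.
Proof.
rewrite -mulr_suml; set den := pval _ _ y.
have -> : \sum_s pval muXY (fun xy => (enum_rank (c.1 xy.1), xy.2)) (s, y) = den.
  rewrite /den /pval [RHS](partition_big (fun xy => enum_rank (c.1 xy.1)) predT)//=.
  by apply: eq_bigr => s _; apply: eq_bigl => xy; rewrite xpair_eqE andbC.
by have [->|nz] := eqVneq den 0; rewrite ?mul0r// divff.
Qed.

Lemma condp_gt0 c x y : 0 < muXY (x, y) -> 0 < condp c (enum_rank (c.1 x)) y.
Proof.
move=> m0; rewrite divr_gt0//.
- exact: (pval_gt0 muXY_pmf (fun xy => (enum_rank (c.1 xy.1), xy.2)) m0).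
- exact: (pval_gt0 muXY_pmf (fun xy => xy.2) m0).
Qed.

(** Conditional information density of the scalar message given Y. *)
Definition info (c : code) (a : X * Y * W) : R :=
  - log2 (condp c (enum_rank (c.1 a.1.1)) a.1.2).

Lemma expect_info c : \sum_a mu a * info c a = crate PX PYX c.
Proof.
rewrite (sum_pXYW PX PYX hPWY (fun x y => - log2 (condp c (enum_rank (c.1 x)) y))).
pose F (xy : X * Y) := (enum_rank (c.1 xy.1), xy.2).
rewrite (expect_eq muXY_pmf (g := fun xy =>
   - log2 (pval muXY F (F xy)) + log2 (pval muXY (fun xy => xy.2) xy.2))); last first.
  move=> xy m0; rewrite /condp log2_div ?opprB 1?addrC//.
  - exact: (pval_gt0 muXY_pmf F m0).
  - exact: (pval_gt0 muXY_pmf (fun xy => xy.2) m0).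
under eq_bigr do rewrite mulrDr mulrN.
rewrite big_split/= sumrN /crate /condEntropy {2}/entropy opprK; congr (_ + _).
apply: (entropy_eq muXY_pmf) => w w'.
by rewrite /F; split=> [[/enum_rank_inj -> ->]|[-> ->]].
Qed.

Definition info_var (c : code) : R := \sum_a mu a * (info c a - crate PX PYX c) ^+ 2.

(** Summing over all codes gives one variance bound valid for every schedule and every n. *)
Definition info_bound : R := \sum_(c : code) info_var c.

Lemma info_var_ge0 c : 0 <= info_var c.
Proof. by apply: sumr_ge0 => a _; rewrite mulr_ge0 ?sqr_ge0 ?mu_pmf.1. Qed.

Lemma info_var_le c : info_var c <= info_bound.
Proof.
rewrite /info_bound (bigD1 c)//= lerDl sumr_ge0// => c' _; exact: info_var_ge0.
Qed.

Section Block.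
Variables (n mK : nat) (pK : 'I_mK -> R).
Hypothesis hpK : is_pmf pK.
Local Notation Om := (Omega X Y W n mK).
Local Notation P := (@pOmega R X Y W PX PYX PWY n mK pK).
Let P_pmf : is_pmf P := pOmega_pmf hPX hPYX hPWY n hpK.

Lemma expect_single (t : 'I_n) (f : X * Y * W -> R) :
  \sum_o P o * f (letter o t) = \sum_a mu a * f a.
Proof.
rewrite (expect_letter hPX hPYX hPWY pK (phi := fun _ a => f a))//.
by rewrite -mulr_suml P_pmf.2 mul1r.
Qed.

(** Cross terms vanish: with letter s frozen, averaging over letter t gives zero. *)
Lemma second_moment (f : 'I_n -> X * Y * W -> R) :
  (forall t, \sum_a mu a * f t a = 0) ->
  \sum_o P o * (\sum_t f t (letter o t)) ^+ 2 = \sum_t \sum_a mu a * f t a ^+ 2.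
Proof.
move=> f0.
rewrite (eq_bigr (fun o => \sum_t \sum_s P o * (f t (letter o t) * f s (letter o s)))).
  rewrite exchange_big/=; apply: eq_bigr => t _; rewrite exchange_big/=.
  rewrite (bigD1 t)//= [X in _ + X]big1 ?addr0.
    by rewrite -(expect_single t (fun a => f t a ^+ 2)); under [RHS]eq_bigr do rewrite expr2.
  move=> s st.
  rewrite (expect_letter hPX hPYX hPWY pK (t := t)
    (phi := fun o a => f t a * f s (letter o s))); last first.
    by move=> o a b; rewrite letter_updO (negbTE st).
  rewrite big1// => o _; under eq_bigr do rewrite mulrA.
  by rewrite -mulr_suml f0 mul0r mulr0.
move=> o _; rewrite expr2 big_distrlr/= mulr_sumr; apply: eq_bigr => t _.
by rewrite mulr_sumr.
Qed.

Lemma chebyshev_block (f : 'I_n -> X * Y * W -> R) (V c : R) :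
  (0 < n)%N -> 0 < c -> (forall t, \sum_a mu a * f t a = 0) ->
  (forall t, \sum_a mu a * f t a ^+ 2 <= V) ->
  \sum_(o | n%:R * c < \sum_t f t (letter o t)) P o <= V / (n%:R * c ^+ 2).
Proof.
move=> n0 c0 f0 fV; have nR : 0 < n%:R :> R by rewrite ltr0n.
have nc0 : 0 < n%:R * c by rewrite mulr_gt0.
rewrite ler_pdivlMr ?mulr_gt0 ?exprn_gt0// -(ler_pM2r nR).
apply: (@le_trans _ _ (\sum_o P o * (\sum_t f t (letter o t)) ^+ 2)); last first.
  rewrite second_moment//; apply: le_trans (ler_sum _ (fun t _ => fV t)) _.
  by rewrite sumr_const card_ord -[X in X <= _]mulr_natr.
have -> (x : R) : x * (n%:R * c ^+ 2) * n%:R = x * (n%:R * c) ^+ 2 by ring.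
rewrite mulr_suml big_mkcond/=; apply: ler_sum => o _.
case: ifPn => [lt|_]; last by rewrite mulr_ge0 ?sqr_ge0 ?P_pmf.1.
by rewrite ler_wpM2l ?P_pmf.1// ler_pXn2r ?nnegrE ?ltW// (lt_trans nc0).
Qed.

Variable j : 'I_n -> code.

Definition enc (t : 'I_n) (k : 'I_mK) (x : {ffun 'I_n -> X}) : 'I_#|X| :=
  enum_rank ((j t).1 (x t)).

Definition dec (t : 'I_n) (k : 'I_mK) (s : {ffun 'I_n -> 'I_#|X|})
    (y : {ffun 'I_n -> Y}) : Xh := (j t).2 (enum_val (s t), y t).

Lemma enc_causal : causal_enc enc.
Proof. by move=> t k x x' E; rewrite /enc E. Qed.

Lemma dec_causal : causal_dec dec.
Proof. by move=> t k s s' y y' E; rewrite /dec; have [-> ->] := E t (leqnn t). Qed.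

Lemma distortion_code (t : 'I_n) :
  \sum_o P o * d (xof o t) (dec t (kof o) (Sseq enc o) (yof o)) = cdist PX PYX d (j t).
Proof.
rewrite /cdist -(sum_pXYW PX PYX hPWY (fun x y => d x ((j t).2 ((j t).1 x, y)))).
rewrite -(expect_single t (fun a => d a.1.1 ((j t).2 ((j t).1 a.1.1, a.1.2)))).
by apply: eq_bigr => o _; rewrite /dec /enc ffunE enum_rankK.
Qed.

Lemma slepian_wolf (B : finType) (L : nat) (c : R) :
  (0 < n)%N -> 0 < c -> #|B| = (2 ^ L)%N ->
  \sum_t crate PX PYX (j t) + 2 * (n%:R * c) <= L%:R ->
  exists (b : {ffun 'I_n -> 'I_#|X|} -> B)
         (db : {ffun 'I_n -> Y} -> B -> {ffun 'I_n -> 'I_#|X|}),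
    \sum_(o | Sseq enc o != db (yof o) (b (Sseq enc o))) P o <=
    info_bound / (n%:R * c ^+ 2) + (1 + n%:R * c * ln 2)^-1.
Proof.
move=> n0 c0 BL rateL; set h := \sum_t _ in rateL.
have nR : 0 < n%:R :> R by rewrite ltr0n.
have nc0 : 0 < n%:R * c by rewrite mulr_gt0.
(* The typicality threshold spends one margin n c, for Chebyshev; at most 1 / th sequences pass it.
   The other n c remains as excess of bins over candidates. *)
pose th : R := 2 `^ (- (h + n%:R * c)).
have th0 : 0 < th by rewrite powR_gt0.
have log_th : log2 th = - (h + n%:R * c).
  by rewrite /log2 ln_powR mulfK// gt_eqF// ln2_gt0.
pose q (y : {ffun 'I_n -> Y}) (s : {ffun 'I_n -> 'I_#|X|}) : R :=
  \prod_t condp (j t) (s t) (y t).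
have q0 y s : 0 <= q y s by apply: prodr_ge0 => t _; exact: condp_ge0.
pose A y : pred _ := fun s => th <= q y s.
have cardA y : #|[set s | A y s]|%:R <= th^-1.
  rewrite -[leRHS]mul1r ler_pdivlMr//.
  apply: (@le_trans _ _ (\sum_(s in [set s | A y s]) q y s)).
    rewrite -sum1_card natr_sum mulr_suml; apply: ler_sum => s.
    by rewrite inE mul1r.
  apply: (@le_trans _ _ (\sum_s q y s)).
    by rewrite [leRHS](bigID (mem [set s | A y s]))/= lerDl sumr_ge0.
  rewrite -(bigA_distr_bigA (fun t s => condp (j t) s (y t))).
  apply: prodr_ile1 => t _; rewrite sum_condp_le1 andbT sumr_ge0// => s _.
  exact: condp_ge0.
have B0 : (0 < #|B|)%N by rewrite BL expn_gt0.
have [b [db err]] := random_binning P_pmf (Sseq enc) (@yof X Y W n mK) B0 cardA.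
exists b, db; apply: (le_trans err); apply: lerD.
  pose f t a := info (j t) a - crate PX PYX (j t).
  have f0 t : \sum_a mu a * f t a = 0.
    under eq_bigr do rewrite mulrBr.
    by rewrite sumrB expect_info -mulr_suml mu_pmf.2 mul1r subrr.
  have := chebyshev_block n0 c0 f0 (fun t => info_var_le (j t)).
  apply: le_trans; rewrite [leLHS]big_mkcond [leRHS]big_mkcond/=; apply: ler_sum => o _.
  case: ifPn => [|_]; last by case: ifP => // _; exact: P_pmf.1.
  rewrite -ltNge => lt; case: ifPn => // /negP nlt.
  have := P_pmf.1 o; rewrite le_eqVlt => /predU1P[<-//|Po]; case: nlt.
  have [_ m0] := pOmega_gt0 hPX hPYX hPWY hpK Po.
  have cp t : 0 < condp (j t) (Sseq enc o t) (yof o t).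
    rewrite ffunE; apply: condp_gt0; have := m0 t.
    rewrite -[mu _]/(muXY (xof o t, yof o t) * PWY (yof o t) (wof o t)).
    move=> mt; rewrite lt_neqAle muXY_pmf.1 andbT eq_sym; move: mt.
    by apply: contraTneq => ->; rewrite mul0r ltxx.
  have lq : log2 (q (yof o) (Sseq enc o)) < log2 th.
    rewrite /log2 ltr_pM2r ?invr_gt0 ?ln2_gt0// ltr_ln ?posrE//.
    by apply: prodr_gt0 => t _.
  rewrite /f sumrB -/h ltrBrDr addrC.
  rewrite (eq_bigr (fun t => - log2 (condp (j t) (Sseq enc o t) (yof o t)))); last first.
    by move=> t _; rewrite /info ffunE.
  by rewrite sumrN -log2_prod// ltrNr -log_th.
rewrite BL natrX -invfM lef_pV2 ?posrE; last first.
- by rewrite addr_gt0// mulr_gt0// ln2_gt0.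
- by rewrite mulr_gt0// exprn_gt0.
(* The collision term is at most 2^(-n c); exp x >= 1 + x turns this into a cruder bound that still
   vanishes. *)
apply: (le_trans (expR_ge1Dx _)).
have thE : th = expR (- (h + n%:R * c) * ln 2).
  by rewrite -[LHS]lnK ?posrE// ln_powR.
have -> : 2 ^+ L = expR (L%:R * ln 2) :> R.
  by rewrite -[LHS]lnK ?posrE ?exprn_gt0// lnXn// -[X in expR X]mulr_natl.
rewrite thE -expRD ler_expR -mulrDl ler_pM2r ?ln2_gt0//; lra.
Qed.

End Block.
(* The bin index is a pair (b1, b2) with 2^m values of b1, and b1 is masked by the
   uniform key as b1 + k mod 2^m; the pair is sent in unary. *)
Lemma direct_block (n m L : nat) (j : 'I_n -> code) (c : R) :
  (0 < n)%N -> 0 < c -> (m <= L)%N ->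
  \sum_t crate PX PYX (j t) + 2 * (n%:R * c) <= L%:R ->
  exists (mK : nat) (pK : 'I_mK -> R)
    (Z : 'I_mK -> {ffun 'I_n -> X} -> seq bool)
    (gZ : 'I_mK -> {ffun 'I_n -> Y} -> seq bool -> {ffun 'I_n -> 'I_#|X|}),
  let P := @pOmega R X Y W PX PYX PWY n mK pK in
  let Zo := fun o : Omega X Y W n mK => Z (kof o) (xof o) in
  [/\ is_pmf pK,
      \sum_(o | Sseq (enc j) o != gZ (kof o) (yof o) (Zo o)) P o <=
        info_bound / (n%:R * c ^+ 2) + (1 + n%:R * c * ln 2)^-1,
      entropy P Zo <= L%:R,
      entropy P (@kof X Y W n mK) <= m%:R &
      n%:R * HXgW PX PYX PWY + m%:R - L%:R <=
        condEntropy P (@xof X Y W n mK) (fun o => (wof o, Zo o))].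
Proof.
move=> n0 c0 mL rateL.
(* Successors, so that the ordinals ['I_q.+1] carry addition modulo 2^m. *)
pose q := (2 ^ m).-1; pose q' := (2 ^ (L - m)).-1.
have qE : q.+1 = (2 ^ m)%N by rewrite prednK// expn_gt0.
have q'E : q'.+1 = (2 ^ (L - m))%N by rewrite prednK// expn_gt0.
pose B := ('I_q.+1 * 'I_q'.+1)%type.
have BL : #|{: B}| = (2 ^ L)%N by rewrite card_prod !card_ord qE q'E -expnD subnKC.
pose pK (k : 'I_q.+1) : R := (2 ^+ m)^-1.
have m0 : 0 < 2 ^+ m :> R by rewrite exprn_gt0.
have hpK : is_pmf pK.
  split=> [k|]; first by rewrite invr_ge0 ltW.
  by rewrite sumr_const card_ord qE -[LHS]mulr_natl natrX divff// gt_eqF.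
have [b [db err]] := slepian_wolf hpK n0 c0 BL rateL.
pose P := @pOmega R X Y W PX PYX PWY n q.+1 pK.
have P_pmf : is_pmf P := pOmega_pmf hPX hPYX hPWY n hpK.
pose bin (k : 'I_q.+1) (x : {ffun 'I_n -> X}) : B := b [ffun t => enc j t k x].
pose mask (k : 'I_q.+1) (beta : B) : B := (beta.1 + k, beta.2).
(* Only the entropy of the string is constrained, not its length, so any injective encoding will
   do. *)
pose Z k x : seq bool := nseq (pickle (mask k (bin k x))) true.
pose gZ (k : 'I_q.+1) y (z : seq bool) :=
  let beta : B := odflt (ord0, ord0) (unpickle (size z)) in
  db y (beta.1 - k, beta.2).
have gZE k x y : gZ k y (Z k x) = db y (bin k x).
  by rewrite /gZ /Z size_nseq pickleK/= addrK; case: (bin k x).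
have Z_inj k k' x x' : Z k x = Z k' x' <-> mask k (bin k x) = mask k' (bin k' x').
  split=> [/(congr1 size)|E]; last by rewrite /Z E.
  by rewrite !size_nseq => /(pcan_inj pickleK).
exists q.+1, pK, Z, gZ => /=; rewrite -/P.
pose Zo (o : Omega X Y W n q.+1) := Z (kof o) (xof o).
have HZ : entropy P Zo <= L%:R.
  rewrite (entropy_eq P_pmf (G := fun o => mask (kof o) (bin (kof o) (xof o)))); last first.
    by move=> o o'; exact: Z_inj.
  apply: le_trans (entropy_le_card P_pmf _ (N := 2 ^ L) _ _) _.
  - by rewrite BL.
  - by rewrite expn_gt0.
  - by rewrite natrX log2X.
split=> //.
- rewrite (eq_bigl (fun o => Sseq (enc j) o != db (yof o) (b (Sseq (enc j) o))))// => o.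
  by rewrite gZE.
- apply: le_trans (entropy_le_card P_pmf _ (N := 2 ^ m) _ _) _.
  - by rewrite card_ord qE.
  - by rewrite expn_gt0.
  - by rewrite natrX log2X.
have HXWZ : entropy P (fun o => (xof o, (wof o, Zo o))) =
    entropy P (fun o => (kof o, (xof o, wof o))).
  apply: (entropy_eq P_pmf) => o o'; split=> [[xE wE]|[kE xE wE]]; last first.
    by rewrite /Zo kE xE wE.
  (* x^n fixes the bin index, so subtracting its first component from the masked one returns the
     key. *)
  move=> /Z_inj/(congr1 (@fst _ _)); rewrite xE wE.
  by move=> /(@addrI _ (bin (kof o) (xof o')).1) ->.
have HW : entropy P (@wof X Y W n q.+1) = n%:R * entropy mu (fun a => a.2).
  rewrite -(entropy_block_nokey hPX hPYX hPWY n hpK).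
  apply: (entropy_eq P_pmf) => o o'; split=> [wE|/ffunP E].
    by apply/ffunP => t; rewrite !ffunE/= wE.
  by apply/ffunP => t; have := E t; rewrite !ffunE.
have HK : entropy P (@kof X Y W n q.+1) = m%:R.
  rewrite -[entropy P (@kof _ _ _ _ _)]/(entropy P (fun o => id (kof o))).
  rewrite (entropy_kof hPX hPYX hPWY) /entropy.
  rewrite (eq_bigr (fun k => pK k * - m%:R)) => [|k _].
    by rewrite -mulr_suml hpK.2 mul1r opprK.
  by rewrite /pval big_pred1_eq log2V// log2X.
have := entropy_pair_le P_pmf (@wof X Y W n q.+1) Zo.
rewrite /condEntropy HXWZ (entropy_keyXW hPX hPYX hPWY n hpK) HK HW.
by move: HZ; rewrite /HXgW /condEntropy mulrBr; lra.
Qed.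

End Direct.

(** * The rate region *)

Section Region.
Variables (R : realType) (X Y W Xh : finType).
Variables (PX : X -> R) (PYX : X -> Y -> R) (PWY : Y -> W -> R) (d : X -> Xh -> R).
Hypotheses (hPX : is_pmf PX) (hPYX : forall x, is_pmf (PYX x)).
Hypothesis hPWY : forall y, is_pmf (PWY y).
Hypothesis hd : forall x xh, 0 <= d x xh.
Variables (Rr Rk D h : R).

Local Notation H := (HXgW PX PYX PWY).
Local Notation ach := (achievable PX PYX d).

Lemma region_converse (delta : R) : 0 < delta -> inRSI PX PYX PWY d Rr Rk D h ->
  [/\ ach (D + delta) (Rr + delta), h <= H + delta &
      ach (D + delta) (Rk - h + H + delta)].
Proof.
move=> delta0 reg.
have X0 := pmf_card_gt0 hPX.
pose l : R := log2 #|X|%:R.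
have l0 : 0 <= l by rewrite -(log2_1 R) ler_log2// ler1n.
(* Fano costs (1 + l) eps per letter; the key and equivocation tolerances in the third bound take
   the other two. *)
pose eps := delta / (3 + l).
have den0 : 0 < 3 + l by rewrite ltr_pwDl.
have eps0 : 0 < eps by rewrite divr_gt0.
have epsE : eps * 3 + eps * l = delta by rewrite -mulrDr divfK// gt_eqF.
have epsl : 0 <= eps * l by rewrite mulr_ge0// ltW.
have [N HN] := reg eps eps0.
(* A single block length suffices; n >= 1 / eps absorbs the additive bit in Fano's bound. *)
pose n := maxn N (Num.truncn eps^-1).+1.
have [|mK [mS [pK [e [g [Z [gZ]]]]]]] := HN n; first exact: leq_maxl.
move=> [hpK [he [hg [err [hZ [hK [hD hh]]]]]]].
have n0 : (0 < n)%N by rewrite (leq_trans _ (leq_maxr _ _)).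
have nR : 0 < n%:R :> R by rewrite ltr0n.
have n_large : 1 <= eps * n%:R.
  rewrite mulrC -ler_pdivrMr// div1r (le_trans (ltW (truncnS_gt _)))//.
  by rewrite ler_nat leq_maxr.
have blk := converse_block d hPX hPYX hPWY hpK he hg n0.
have msg := entropy_message_ge hPX hPYX hPWY hpK e Z gZ.
have msgZ := condEntropy_message_le hPX hPYX hPWY hpK Z.
have eqv1 := equivocation_le_source hPX hPYX hPWY hpK Z.
have eqv2 := equivocation_le_key hPX hPYX hPWY hpK Z.
move: hZ hK hh msg msgZ eqv1 eqv2 blk.
rewrite !ler_pdivrMr// ler_pdivlMr// -/l.
set P := pOmega PX PYX PWY pK in err hD *.
set er := (\sum_(o | _) _) in err *.
set HZ := entropy P _; set HK := entropy P _; set HX := condEntropy P _ _.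
set HS := condEntropy P (Sseq e) _; set HC := condEntropy P _ (fun o => (kof o, _)).
move=> hZ hK hh msg msgZ eqv1 eqv2 blk.
have fano_small : 1 + er * (n%:R * l) <= (eps + eps * l) * n%:R.
  have nl0 : 0 <= n%:R * l by rewrite mulr_ge0// ltW.
  by have := ler_wpM2r nl0 (ltW err); lra.
have deltaE : delta * n%:R = eps * 3 * n%:R + eps * l * n%:R by rewrite -epsE mulrDl.
have epsn0 : 0 <= eps * n%:R by rewrite mulr_ge0 ?ltW.
have epsln0 : 0 <= eps * l * n%:R by rewrite mulr_ge0// ltW.
have D_le : D + eps <= D + delta by lra.
split.
- apply: achievable_le blk; first exact: le_trans D_le.
  by rewrite ler_pdivrMr//; lra.
- by rewrite -(ler_pM2r nR); lra.
- apply: achievable_le blk; first exact: le_trans D_le.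
  by rewrite ler_pdivrMr//; lra.
Qed.

(** At compression rate r the scheme has equivocation rate about H + min(0, Rk - r), which is at
    least h when h <= H and r <= Rk - h + H. *)
Lemma region_direct : 0 < Rk ->
  (forall delta : R, 0 < delta -> ach D (Rr + delta)) -> h <= H ->
  (forall delta : R, 0 < delta -> ach D (Rk - h + H + delta)) ->
  inRSI PX PYX PWY d Rr Rk D h.
Proof.
move=> Rk0 achR hH achK eps eps0.
pose del := eps / 8; have del0 : 0 < del by rewrite divr_gt0.
have epsE : eps = 8 * del by rewrite /del; field.
(* r is the smaller of the two bounds, so that one mixture meets both the rate and the key
   constraint. *)
have [r rR [rK achr]] : exists2 r, r <= Rr & r <= Rk - h + H /\ ach D (r + del).
  have [le|lt] := leP Rr (Rk - h + H); first by exists Rr => //; split=> //; exact: achR.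
  by exists (Rk - h + H); [exact: ltW|split=> //; exact: achK].
have [lam [hlam lamD lamr]] := achr.
pose Cr := \sum_(c : {ffun X -> X} * {ffun X * Y -> Xh}) crate PX PYX c.
pose Cd := \sum_c cdist PX PYX d c.
pose V := info_bound Xh PX PYX PWY.
have Cr0 : 0 <= Cr by apply: sumr_ge0 => c _; exact: crate_ge0.
have Cd0 : 0 <= Cd by apply: sumr_ge0 => c _; exact: cdist_ge0.
have V0 : 0 <= V by apply: sumr_ge0 => c _; exact: info_var_ge0.
have r0 : 0 <= r + del.
  by apply: le_trans lamr; apply: sumr_ge0 => c _; rewrite mulr_ge0 ?hlam.1 ?crate_ge0.
have ln0 := ln2_gt0 R.
have b1_0 : 0 <= (Cr + 2) / del by rewrite divr_ge0 ?ltW// ltr_wpDl.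
have b2_0 : 0 <= Cd / del by rewrite divr_ge0// ltW.
have b3_0 : 0 <= V / (del * del ^+ 2) by rewrite divr_ge0// mulr_ge0 ?exprn_ge0 ?ltW.
have b4_0 : 0 <= (del * (del * ln 2))^-1 by rewrite invr_ge0 !mulr_ge0 ?ltW.
(* One summand for each of [n1] to [n4]. The 2 pays for rounding L up and m down. *)
pose big := (Cr + 2) / del + Cd / del + V / (del * del ^+ 2) + (del * (del * ln 2))^-1.
exists (Num.truncn big).+1 => n Nn.
have nbig : big < n%:R.
  by rewrite (lt_le_trans (truncnS_gt _))// ler_nat.
have n0 : (0 < n)%N by exact: leq_trans Nn.
have nR : 0 < n%:R :> R by rewrite ltr0n.
have n1 : Cr + 2 <= n%:R * del by rewrite -ler_pdivrMr//; rewrite /big in nbig; lra.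
have n2 : Cd <= n%:R * del by rewrite -ler_pdivrMr//; rewrite /big in nbig; lra.
have n3 : V / (n%:R * del ^+ 2) <= del.
  rewrite ler_pdivrMr ?mulr_gt0 ?exprn_gt0// mulrCA -ler_pdivrMr ?mulr_gt0 ?exprn_gt0//.
  by rewrite /big in nbig; lra.
have n4 : (1 + n%:R * del * ln 2)^-1 <= del.
  have nd0 : 0 < n%:R * del * ln 2 by rewrite !mulr_gt0.
  apply: (@le_trans _ _ (n%:R * del * ln 2)^-1).
    by rewrite lef_pV2 ?posrE ?addr_gt0// lerDr.
  rewrite -[leRHS]invrK lef_pV2 ?posrE ?invr_gt0// -mulrA -ler_pdivrMr ?mulr_gt0//.
  by rewrite -invfM; rewrite /big in nbig; lra.
have [j jP] := time_sharing n hlam.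
have jr := jP _ (crate_ge0 hPX hPYX); have jd := jP _ (cdist_ge0 hPX hPYX hd).
have := ler_wpM2l (ltW nR) lamr; have := ler_wpM2l (ltW nR) lamD.
rewrite -/Cr -/Cd in jr jd => nlamD nlamr.
pose a := n%:R * (r + del) + Cr + 2 * (n%:R * del).
have a0 : 0 <= a by rewrite !addr_ge0// !mulr_ge0// ltW.
pose L := (Num.truncn a).+1.
have L_ge : a <= L%:R by rewrite ltW// truncnS_gt.
have L_le : L%:R <= a + 1 by rewrite -[L%:R]natr1 lerD2r truncn_le.
(* With key to spare the whole index is masked and the equivocation is full; otherwise all n Rk key
   bits, rounded down, are used. *)
pose m := minn L (Num.truncn (n%:R * Rk)).
have nRk0 : 0 <= n%:R * Rk by rewrite mulr_ge0// ltW.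
have m_le : m%:R <= n%:R * Rk.
  by apply: (@le_trans _ _ (Num.truncn (n%:R * Rk))%:R);
    rewrite ?truncn_le// ler_nat geq_minr.
have [|mK [pK [Z [gZ [hpK err hZ hK hX]]]]] :=
  direct_block hPX hPYX hPWY n0 del0 (geq_minl L _ : m <= L)%N (j := j).
  by rewrite /a in L_ge; lra.
exists mK, #|X|, pK, (enc j), (dec j), Z, gZ => /=.
split=> //; split; first exact: enc_causal.
split; first exact: dec_causal.
split; first by apply: (le_lt_trans err); rewrite -/V; lra.
rewrite !ler_pdivrMr// ler_pdivlMr//.
split; first by apply: (le_trans hZ); rewrite /a in L_le; nra.
split; first by apply: (le_trans hK); nra.
split.
  under eq_bigr do rewrite distortion_code//.
  by apply: (le_trans jd); nra.
apply: le_trans hX.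
have [mL|mK'] : m = L \/ n%:R * Rk < m%:R + 1.
  rewrite /m; case: leqP => _; [by left|right].
  by rewrite natr1 truncnS_gt.
  by rewrite mL; nra.
by rewrite /a in L_le; nra.
Qed.

End Region.

Theorem theorem6 (R : realType) (X Y W Xh : finType)
  (PX : X -> R) (PYX : X -> Y -> R) (PWY : Y -> W -> R) (d : X -> Xh -> R)
  (hPX : is_pmf PX) (hPYX : forall x, is_pmf (PYX x)) (hPWY : forall y, is_pmf (PWY y))
  (hd : forall x xh, 0 <= d x xh)
  (Rr Rk D h : R) (hR : 0 < Rr) (hRk : 0 < Rk) (hD : 0 < D) (hh : 0 < h) :
  inRSI PX PYX PWY d Rr Rk D h <->
  [/\ (lce (rcSI PX PYX d) D <= Rr%:E)%E,
      h <= HXgW PX PYX PWY &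
      ((h - HXgW PX PYX PWY)%:E + lce (rcSI PX PYX d) D <= Rk%:E)%E].
Proof.
(* The real terms move to the right, so that both envelope inequalities have the form required by
   [lceP]. *)
rewrite addeC -leeBrDr// -EFinB (_ : Rk - _ = Rk - h + HXgW PX PYX PWY); last by lra.
split=> [reg|[lceR hH lceK]].
- split.
  + apply/lceP => //; apply: achievable_right_continuous => // delta delta0.
    by have [] := region_converse hPX hPYX hPWY delta0 reg.
  + apply/ler_addgt0Pr => delta delta0.
    by have [] := region_converse hPX hPYX hPWY delta0 reg.
  + apply/lceP => //; apply: achievable_right_continuous => // delta delta0.
    by have [] := region_converse hPX hPYX hPWY delta0 reg.
- by apply: region_direct => //; apply/lceP.
Qed.
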